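(* Let $(A,\le)$ be a standardly stratified algebra, $T$ its characteristic module, and $d$ a non-negative integer. Then the following are equivalent: (1) $\overline{\nabla}\text{-}\mathrm{gfd}(A)=d$ (the $\overline{\nabla}$-good filtration dimension of the algebra $A$); (2) $\mathrm{proj.dim}_A(T)=d$; (3) $\overline{\nabla}\text{-}\mathrm{gfd}({}_AA)=d$ (the $\overline{\nabla}$-good filtration dimension of the left $A$-module ${}_AA$); (4) $T\text{-}\mathrm{codim}({}_AA)=d$.
   Context: Setting: $R$ is a commutative Artin ring, $A$ is a basic Artin $R$-algebra, and $A\text{-mod}$ is the category of finitely generated left $A$-modules. Fix an ordered complete set $e_1,\dots,e_n$ of primitive orthogonal idempotents of $A$; put $\Lambda=\{1,\dots,n\}$ with its natural order $\le$. For $i\in\Lambda$, $P(i)=Ae_i$, $E(i)$ is the simple top of $P(i)$, and $I(i)$ is the injective envelope of $E(i)$. Standard and proper costandard modules: $\Delta(i)$ is the maximal factor module of $P(i)$ having no composition factor $E(j)$ with $j>i$. Dually, the costandard module $\nabla(i)$ is the maximal submodule of $I(i)$ having no composition factor $E(j)$ with $j>i$, and the proper costandard module $\overline{\nabla}(i)$ is the maximal submodule of $\nabla(i)$ in which $E(i)$ occurs as a composition factor with multiplicity exactly $1$. For a class $\Theta$ of $A$-modules, $\mathcal F(\Theta)$ is the full subcategory of $A\text{-mod}$ of modules having a finite filtration whose successive factors are isomorphic to objects of $\Theta$. Here $\Delta=\{\Delta(i)\}_{i\in\Lambda}$ and $\overline{\nabla}=\{\overline{\nabla}(i)\}_{i\in\Lambda}$.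 $(A,\le)$ is standardly stratified if ${}_AA\in\mathcal F(\Delta)$. In that case there is a unique basic module $T$, the characteristic (full tilting) module, a generalized tilting module with $\mathrm{add}(T)=\mathcal F(\Delta)\cap\mathcal F(\overline{\nabla})$. For $X\in A\text{-mod}$, $\overline{\nabla}\text{-}\mathrm{gfd}(X)$ is the smallest $d\ge0$ for which there is an exact sequence $0\to X\to M_0\to\cdots\to M_d\to0$ with all $M_i\in\mathcal F(\overline{\nabla})$ (such a finite sequence always exists). For the algebra, $\overline{\nabla}\text{-}\mathrm{gfd}(A)=\sup\{\overline{\nabla}\text{-}\mathrm{gfd}(X): X\in A\text{-mod}\}$; the notation $\overline{\nabla}\text{-}\mathrm{gfd}({}_AA)$ refers to the left module ${}_AA$. $T\text{-}\mathrm{codim}(X)$ is the smallest $s\ge0$ for which there is an exact sequence $0\to X\to T_0\to\cdots\to T_s\to0$ with $T_i\in\mathrm{add}(T)$ for all $i$. *)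

(* Defs.v *)
From HB Require Import structures.
From mathcomp Require Export all_boot all_order all_algebra.
From mathcomp Require Export boolp.

Set Implicit Arguments.
Unset Strict Implicit.
Unset Printing Implicit Defensive.

Import GRing.Theory.
Local Open Scope ring_scope.

(* Left modules over A are terms of type [lmodType A].  Objects that the
   theory only determines up to isomorphism (factor modules, injective
   envelopes) are described by predicates on modules. *)

Definition surj (X Y : Type) (f : X -> Y) : Prop := forall y, exists x, f x = y.

Section Submodules.
Variables (A : pzRingType) (M : lmodType A).

Record submod_type (U : submodClosed M) :=
  SubMod { submod_val : M; submod_valP : submod_val \in U }.

Variable U : submodClosed M.

HB.instance Definition _ := [isSub for @submod_val U].
HB.instance Definition _ := [Choice of submod_type U by <:].
HB.instance Definition _ := [SubChoice_isSubLmodule of submod_type U by <:].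

(* N is isomorphic to the factor module U / V. *)
Definition is_factor (V : submodClosed M) (N : lmodType A) : Prop :=
  {subset V <= U} /\
  exists g : {linear submod_type U -> N},
    surj g /\ forall x, g x = 0 <-> submod_val x \in V.

Definition maximal_submod : Prop :=
  (exists x, x \notin U) /\
  forall V : submodClosed M, {subset U <= V} -> (V =i U) \/ (V =i predT).

End Submodules.

Section LeftIdeal.
Variables (A : nzRingType) (e : A).

Definition left_ideal : {pred A^o} :=
  fun x : A^o => `[< exists a : A, x = a * e >].

Fact left_ideal_add : addr_closed left_ideal.
Proof.
split=> [|x y /asboolP[a ->] /asboolP[b ->]]; apply/asboolP.
  by exists 0; rewrite mul0r.
by exists (a + b); rewrite mulrDl.
Qed.

Fact left_ideal_scale : GRing.scaler_closed left_ideal.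
Proof.
move=> c x /asboolP[a ->]; apply/asboolP.
by exists (c * a); rewrite -mulrA.
Qed.

HB.instance Definition _ := GRing.isAddClosed.Build A^o left_ideal left_ideal_add.
HB.instance Definition _ :=
  GRing.isScaleClosed.Build A A^o left_ideal left_ideal_scale.

(* The left module A e. *)
Definition principal : lmodType A := submod_type left_ideal.

End LeftIdeal.

Section Modules.
Variable A : nzRingType.
Implicit Types (M N X Y E I T : lmodType A) (C Theta : lmodType A -> Prop).

Definition zero_mod M : Prop := forall x : M, x = 0.

Definition iso_mod M N : Prop := exists f : {linear M -> N}, bijective f.

Definition fin_gen M : Prop :=
  exists (m : nat) (x : 'I_m -> M),
    forall y, exists a : 'I_m -> A, y = \sum_(i < m) a i *: x i.

Definition simple_mod M : Prop :=
  ~ zero_mod M /\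
  forall U : submodClosed M, (forall x, x \in U -> x = 0) \/ (U =i predT).

Definition indecomposable M : Prop :=
  ~ zero_mod M /\
  forall X Y, iso_mod M (X * Y)%type -> zero_mod X \/ zero_mod Y.

Definition is_direct_sum M m (N : 'I_m -> lmodType A) : Prop :=
  exists (iota : forall i, {linear N i -> M})
         (pi : forall i, {linear M -> N i}),
    [/\ forall i (x : N i), pi i (iota i x) = x,
        forall i j (x : N i), i != j -> pi j (iota i x) = 0
      & forall x : M, x = \sum_(i < m) iota i (pi i x)].

(* M is a direct sum of pairwise non-isomorphic indecomposable modules. *)
Definition basic_mod M : Prop :=
  exists (m : nat) (N : 'I_m -> lmodType A),
    [/\ is_direct_sum M N,
        forall i, indecomposable (N i)
      & forall i j, iso_mod (N i) (N j) -> i = j].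

(* M is isomorphic to a direct summand of T^m for some m. *)
Definition in_add T M : Prop :=
  exists (m : nat) (M' : lmodType A),
    iso_mod {ffun 'I_m -> T} (M * M')%type.

Definition projective_mod M : Prop :=
  forall X Y (p : {linear X -> Y}) (f : {linear M -> Y}),
    surj p -> exists h : {linear M -> X}, forall x, p (h x) = f x.

Definition injective_mod M : Prop :=
  forall X Y (j : {linear X -> Y}) (f : {linear X -> M}),
    injective j -> exists h : {linear Y -> M}, forall x, h (j x) = f x.

(* Membership in A-mod (finite generation) is part of the definition. *)
Definition is_injective_envelope E I : Prop :=
  [/\ fin_gen I, injective_mod I
    & exists j : {linear E -> I},
        injective j /\
        forall U : submodClosed I,
          (forall x, j x \in U -> x = 0) -> forall y, y \in U -> y = 0].

(* E is isomorphic to M / rad M, where rad M is the intersection of the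
   maximal submodules of M. *)
Definition is_top M E : Prop :=
  exists p : {linear M -> E},
    surj p /\
    forall x, p x = 0 <->
      (forall U : submodClosed M, maximal_submod U -> x \in U).

(* 0 = U_0 <= U_1 <= ... <= U_m = M with U_(k+1) / U_k isomorphic to N_k;
   values of U beyond m and of N from m on are irrelevant. *)
Definition filtration M (m : nat) (U : nat -> submodClosed M)
    (N : nat -> lmodType A) : Prop :=
  [/\ forall x, x \in U 0%N <-> x = 0,
      U m =i predT
    & forall k, (k < m)%N -> is_factor (U k.+1) (U k) (N k)].

Definition filtered Theta M : Prop :=
  exists (m : nat) (U : nat -> submodClosed M) (N : nat -> lmodType A),
    filtration m U N /\
    forall k, (k < m)%N -> exists2 D, Theta D & iso_mod (N k) D.

(* Some composition series of M has exactly r factors isomorphic to E; by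
   Jordan-Hoelder, r does not depend on the series. *)
Definition comp_mult M E (r : nat) : Prop :=
  exists (m : nat) (U : nat -> submodClosed M) (N : nat -> lmodType A)
         (J : {set 'I_m}),
    [/\ filtration m U N,
        forall k, (k < m)%N -> simple_mod (N k),
        forall k : 'I_m, k \in J <-> iso_mod (N k) E
      & #|J| = r].

(* N is, up to isomorphism, the largest factor module of M satisfying Q. *)
Definition largest_factor (Q : lmodType A -> Prop) M N : Prop :=
  Q N /\
  exists p : {linear M -> N},
    surj p /\
    forall N' (p' : {linear M -> N'}),
      Q N' -> surj p' -> forall x, p x = 0 -> p' x = 0.

(* N is, up to isomorphism, the largest submodule of M satisfying Q. *)
Definition largest_submod (Q : lmodType A -> Prop) M N : Prop :=
  Q N /\
  exists j : {linear N -> M},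
    injective j /\
    forall N' (j' : {linear N' -> M}),
      Q N' -> injective j' -> forall y, exists x, j' y = j x.

(* An exact sequence 0 -> X -> M_0 -> ... -> M_d -> 0 with all M_i in C,
   extended by zero modules to the right of M_d. *)
Definition coresolution C X (d : nat) : Prop :=
  exists (M : nat -> lmodType A) (eps : {linear X -> M 0%N})
         (f : forall i, {linear M i -> M i.+1}),
    [/\ injective eps,
        forall y, f 0%N y = 0 <-> exists x, eps x = y,
        forall i y, f i.+1 y = 0 <-> exists x, f i x = y,
        forall i, (i <= d)%N -> C (M i)
      & forall i, (d < i)%N -> zero_mod (M i)].

(* An exact sequence 0 -> M_d -> ... -> M_0 -> X -> 0 with all M_i in C,
   extended by zero modules to the left of M_d. *)
Definition resolution C X (d : nat) : Prop :=
  exists (M : nat -> lmodType A) (eps : {linear M 0%N -> X})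
         (f : forall i, {linear M i.+1 -> M i}),
    [/\ surj eps,
        forall y, eps y = 0 <-> exists x, f 0%N x = y,
        forall i y, f i y = 0 <-> exists x, f i.+1 x = y,
        forall i, (i <= d)%N -> C (M i)
      & forall i, (d < i)%N -> zero_mod (M i)].

Definition is_least (P : nat -> Prop) (d : nat) : Prop :=
  P d /\ forall k, P k -> (d <= k)%N.

Definition is_coresdim C X (d : nat) : Prop := is_least (coresolution C X) d.

(* d is the supremum of the C-coresolution dimensions of the objects of A-mod. *)
Definition is_sup_coresdim C (d : nat) : Prop :=
  is_least (fun b => forall X, fin_gen X ->
              exists2 k, is_coresdim C X k & (k <= b)%N) d.

Definition is_projdim X (d : nat) : Prop :=
  is_least (resolution (fun P => fin_gen P /\ projective_mod P) X) d.

End Modules.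

Definition artinian_ring (R : comNzRingType) : Prop :=
  forall J : nat -> submodClosed R^o,
    (forall k, {subset J k.+1 <= J k}) ->
    exists N, forall k, (N <= k)%N -> J k =i J N.

Definition artin_algebra (R : comNzRingType) (A : algType R) : Prop :=
  artinian_ring R /\ fin_gen (A : lmodType R).

Section Stratification.
Variables (A : nzRingType) (n : nat).
Implicit Types (e : 'I_n -> A) (P E I Delta nabla pnabla : 'I_n -> lmodType A).

Definition primitive_idem (x : A) : Prop :=
  [/\ x != 0, x * x = x
    & forall f g : A, f * f = f -> g * g = g -> f * g = 0 -> g * f = 0 ->
        x = f + g -> f = 0 \/ g = 0].

Definition complete_primitive_orthogonal e : Prop :=
  [/\ forall i, primitive_idem (e i),
      forall i j, i != j -> e i * e j = 0
    & \sum_(i < n) e i = 1].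

(* A is basic: the modules A e_i are pairwise non-isomorphic. *)
Definition basic_idempotents e : Prop :=
  forall i j, iso_mod (principal (e i)) (principal (e j)) -> i = j.

Definition no_factor_above E (i : 'I_n) (M : lmodType A) : Prop :=
  forall j : 'I_n, (i < j)%N -> comp_mult M (E j) 0.

Definition is_standard P E Delta : Prop :=
  forall i, largest_factor (no_factor_above E i) (P i) (Delta i).

Definition is_costandard I E nabla : Prop :=
  forall i, largest_submod (no_factor_above E i) (I i) (nabla i).

Definition is_proper_costandard nabla E pnabla : Prop :=
  forall i, largest_submod (fun M => comp_mult M (E i) 1) (nabla i) (pnabla i).

Definition family_class Delta : lmodType A -> Prop :=
  fun M => exists i, M = Delta i.

Definition filtered_by Delta : lmodType A -> Prop := filtered (family_class Delta).

Definition standardly_stratified Delta : Prop := filtered_by Delta A^o.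

(* T is the basic module with add(T) equal to the intersection of
   F(Delta) and F(proper nabla); this determines T up to isomorphism.  That T
   is a generalized tilting module is a consequence, not a requirement. *)
Definition is_characteristic Delta pnabla (T : lmodType A) : Prop :=
  [/\ fin_gen T, basic_mod T
    & forall M, in_add T M <-> filtered_by Delta M /\ filtered_by pnabla M].

End Stratification.

(* Main.v *)
From HB Require Import structures.
Require Import Defs.
From mathcomp Require classical_sets.

(* Write B for F(proper nabla); it is the class of finitely generated Y with
   Ext^1(Delta(i), Y) = 0 for all i, and the standard stratification makes it
   closed under cokernels of monomorphisms and makes proj.dim Delta(i) finite.
   Every finitely generated X embeds into some Y in B with cokernel in F(Delta),
   so that "X has good filtration dimension <= d" becomes the vanishing of
   Ext^(d+1)(D, X) for all D in the class perpendicular to B.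
   Dimension shifting along free_mod presentations, downwards from a large degree,
   shows that A is the worst module, giving (3) => (1), and (1) => (2) holds
   because T is in F(Delta).  If proj.dim T = d, then a coresolution of A by
   add T splits off after step d, giving (2) => (4); and (4) => (3) holds because
   add T is contained in B. *)

Set Implicit Arguments.
Unset Strict Implicit.
Unset Printing Implicit Defensive.

Import GRing.Theory.
Local Open Scope ring_scope.

(** * Submodules, quotients and exact sequences *)

(** No Ext group is ever constructed: Ext^1 enters as an extension property of maps, Ext^(d+1)(D, X)
    as Ext^1 of d-fold syzygies of D, and each needed piece of a long exact sequence is proved by
    hand. The large degree is [n]. The kernel of P(i) -> Delta(i) is the trace in P(i) of the P(l)
    with l > i, hence a summand of the corresponding trace in A, which the standard stratification
    filters by the Delta(l) with l > i. So Ext^2(Delta(i), -) is controlled by the Ext^1(Delta(l),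
    -) with l > i; each passage from X to the cokernel of an embedding into a good module makes one
    more Ext^1(Delta(i), -) vanish, from the largest index downwards, and [n] passages suffice. The
    embedding itself is built by universal extensions, which need Hom(K, X) to be generated by
    finitely many maps with central coefficients; this comes from the finite generation of A over R.
    Composition multiplicities are read off the idempotents: E(i) is a composition factor of M
    exactly when e_i M is nonzero. *)

Section Tools.
Variable A : nzRingType.
Implicit Types M N Q W X Y Z : lmodType A.

Section LinFun.
Variables (X Y : lmodType A) (f : X -> Y).

Definition lin_of (hf : linear f) := f.
HB.instance Definition _ hf := GRing.isLinear.Build A X Y _ (lin_of hf) hf.
Definition mklin (hf : linear f) : {linear X -> Y} := lin_of hf.
End LinFun.

(** Linearity of [R] reduces single-valuedness to the third hypothesis, since the difference of two
    values at [x] is a value at 0. Maps given on representatives or on sums of submodules are built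
    this way. *)
Lemma lin_of_rel X Y (R : X -> Y -> Prop) :
  (forall x, exists y, R x y) ->
  (forall a x y x' y', R x y -> R x' y' -> R (a *: x + x') (a *: y + y')) ->
  (forall y, R 0 y -> y = 0) ->
  exists f : {linear X -> Y}, forall x, R x (f x).
Proof.
move=> tot lin fn.
have uniqR x y y' : R x y -> R x y' -> y = y'.
  move=> Ry Ry'; apply/eqP; rewrite -subr_eq0; apply/eqP/fn.
  have := lin (-1) _ _ _ _ Ry' Ry.
  by rewrite !scaleN1r addNr [- y' + y]addrC.
pose f x := projT1 (cid (tot x)).
have Rf x : R x (f x) by rewrite /f; case: (cid _).
have linf : linear f by move=> a x y; apply: uniqR (Rf _) (lin _ _ _ _ _ (Rf _) (Rf _)).
by exists (mklin linf).
Qed.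

Definition submodule M (U : M -> Prop) : Prop :=
  U 0 /\ forall a x y, U x -> U y -> U (a *: x + y).

Lemma smD M (U : M -> Prop) x y : submodule U -> U x -> U y -> U (x + y).
Proof. by case=> _ h ux uy; rewrite -[x]scale1r; apply: h. Qed.

Lemma smZ M (U : M -> Prop) a x : submodule U -> U x -> U (a *: x).
Proof. by case=> h0 h ux; rewrite -[_ *: _]addr0; apply: h. Qed.

Lemma smN M (U : M -> Prop) x : submodule U -> U x -> U (- x).
Proof. by move=> h ux; rewrite -scaleN1r; apply: smZ. Qed.

Lemma smB M (U : M -> Prop) x y : submodule U -> U x -> U y -> U (x - y).
Proof. by move=> h ux uy; apply: smD => //; apply: smN. Qed.

Section SubOf.
Variables (M : lmodType A) (U : M -> Prop).

Definition sub_pred (h : submodule U) : {pred M} := fun x => `[< U x >].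

Variable h : submodule U.

Fact sub_pred_add : addr_closed (sub_pred h).
Proof.
split=> [|x y /asboolP ux /asboolP uy]; apply/asboolP; first by case: h.
exact: smD.
Qed.

Fact sub_pred_scale : GRing.scaler_closed (sub_pred h).
Proof. by move=> a x /asboolP ux; apply/asboolP; exact: smZ. Qed.

HB.instance Definition _ := GRing.isAddClosed.Build M (sub_pred h) sub_pred_add.
HB.instance Definition _ :=
  GRing.isScaleClosed.Build A M (sub_pred h) sub_pred_scale.

Definition sub_of : submodClosed M := sub_pred h.

Lemma sub_ofE x : (x \in sub_of) <-> U x.
Proof. by split=> [/asboolP|ux] //; apply/asboolP. Qed.

End SubOf.

Lemma sm_mem M (U : submodClosed M) : submodule (fun x => x \in U).
Proof.
split=> [|a x y ux uy]; first exact: rpred0.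
by apply: rpredD => //; apply: rpredZ.
Qed.

Lemma sm_all M : submodule (fun _ : M => True).
Proof. by []. Qed.

Lemma sm_zero M : submodule (fun x : M => x = 0).
Proof. by split=> // a x y -> ->; rewrite scaler0 addr0. Qed.

Lemma sm_preim M N (f : {linear M -> N}) (U : N -> Prop) :
  submodule U -> submodule (fun x => U (f x)).
Proof. by case=> h0 h; split=> [|a x y]; rewrite ?linear0 ?linearP //; apply: h. Qed.

Lemma sm_im M N (f : {linear M -> N}) (U : M -> Prop) :
  submodule U -> submodule (fun y => exists2 x, U x & f x = y).
Proof.
move=> [h0 h]; split=> [|a _ _ [x ux <-] [y uy <-]].
  by exists 0; rewrite ?linear0.
by exists (a *: x + y); rewrite ?linearP //; apply: h.
Qed.

Lemma sm_range M N (f : {linear M -> N}) : submodule (fun y => exists x, f x = y).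
Proof.
split=> [|a _ _ [x <-] [y <-]]; first by exists 0; rewrite linear0.
by exists (a *: x + y); rewrite linearP.
Qed.

Lemma sm_ker M N (f : {linear M -> N}) : submodule (fun x => f x = 0).
Proof. exact: (sm_preim f (sm_zero N)). Qed.

Lemma sm_add M (U V : M -> Prop) : submodule U -> submodule V ->
  submodule (fun x => exists2 u, U u & V (x - u)).
Proof.
move=> [u0 hU] [v0 hV]; split=> [|a x y [u ux vx] [v vy wy]].
  by exists 0; rewrite ?subr0.
exists (a *: u + v); first exact: hU.
by rewrite opprD addrACA -scalerBr; apply: hV.
Qed.

Lemma linval_proof M (U : submodClosed M) : linear (@submod_val A M U).
Proof. by []. Qed.
Definition subval M (U : submodClosed M) : {linear submod_type U -> M} :=
  mklin (@linval_proof M U).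

Lemma subval_inj M (U : submodClosed M) : injective (subval U).
Proof. exact: (@val_inj _ _ (submod_type U)). Qed.

Lemma subval_im M (U : submodClosed M) y : y \in U <-> exists x, subval U x = y.
Proof. by split=> [yU|[x <-]]; [exists (SubMod yU) | exact: submod_valP]. Qed.

Lemma sub_ex M (U : M -> Prop) : submodule U ->
  exists N (j : {linear N -> M}),
    injective j /\ forall y, U y <-> exists x, j x = y.
Proof.
move=> h; exists (submod_type (sub_of h)), (subval _); split; first exact: subval_inj.
by move=> y; rewrite -(sub_ofE h) subval_im.
Qed.

Section Quotient.
Variables (M : lmodType A) (U : M -> Prop).

(** The factor module lives on canonical representatives: [choose] returns the same element for all
    points of a coset, so [quo] is a subtype of [M] and inherits its choice structure. *)
Definition qcanon (h : submodule U) (x : M) : M := choose (fun y => `[< U (x - y) >]) x.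

Record quo (h : submodule U) := Quo { qrepr : M; qreprP : qcanon h qrepr == qrepr }.

Variable h : submodule U.

HB.instance Definition _ := [isSub for @qrepr h].
HB.instance Definition _ := [Choice of quo h by <:].

Lemma qcanonP x : U (x - qcanon h x).
Proof.
apply/asboolP; apply: (@chooseP _ (fun y => `[< U (x - y) >])).
by rewrite subrr; apply/asboolP; case: h.
Qed.

Lemma qcanon_eq x y : U (x - y) -> qcanon h x = qcanon h y.
Proof.
move=> uxy; rewrite /qcanon.
have E : (fun z => `[< U (x - z) >]) =1 (fun z => `[< U (y - z) >]).
  move=> z; apply/asboolP/asboolP => uz.
    have -> : y - z = (x - z) - (x - y) by rewrite opprB [RHS]addrC addrA subrK.
    exact: smB.
  have -> : x - z = (x - y) + (y - z) by rewrite addrA subrK.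
  exact: smD.
rewrite (eq_choose E); apply: choose_id; apply/asboolP.
  by rewrite -opprB; apply: smN.
by rewrite subrr; case: h.
Qed.

Lemma qcanonK x : qcanon h (qcanon h x) == qcanon h x.
Proof. by apply/eqP/esym/qcanon_eq/qcanonP. Qed.

Definition qpi x : quo h := Quo (qcanonK x).

Lemma qpi_eq x y : qpi x = qpi y <-> U (x - y).
Proof.
split=> [[exy]|uxy]; last by apply: val_inj; apply: qcanon_eq.
have hx := qcanonP x; have hy := qcanonP y.
have -> : x - y = (x - qcanon h x) - (y - qcanon h y) by rewrite exy opprB addrA subrK.
exact: smB.
Qed.

Lemma qreprK q : qpi (qrepr q) = q.
Proof. by apply: val_inj; case: q => x /= /eqP. Qed.

Lemma qpiP q : exists x, q = qpi x.
Proof. by exists (qrepr q); rewrite qreprK. Qed.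

Definition qadd (p q : quo h) := qpi (qrepr p + qrepr q).
Definition qopp (p : quo h) := qpi (- qrepr p).
Definition qscale a (p : quo h) := qpi (a *: qrepr p).

Lemma qrepr_pi x : U (qrepr (qpi x) - x).
Proof. by rewrite -opprB; apply: smN => //; apply: qcanonP. Qed.

Lemma qaddE x y : qadd (qpi x) (qpi y) = qpi (x + y).
Proof. by apply/qpi_eq; rewrite opprD addrACA; apply: smD => //; apply: qrepr_pi. Qed.
Lemma qoppE x : qopp (qpi x) = qpi (- x).
Proof. by apply/qpi_eq; rewrite -opprD; apply: smN => //; apply: qrepr_pi. Qed.
Lemma qscaleE a x : qscale a (qpi x) = qpi (a *: x).
Proof. by apply/qpi_eq; rewrite -scalerBr; apply: smZ => //; apply: qrepr_pi. Qed.

Fact qaddA : associative qadd.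
Proof.
move=> p q r; case: (qpiP p) (qpiP q) (qpiP r) => x -> [y ->] [z ->].
by rewrite !qaddE addrA.
Qed.
Fact qaddC : commutative qadd.
Proof. by move=> p q; case: (qpiP p) (qpiP q) => x -> [y ->]; rewrite !qaddE addrC. Qed.
Fact qadd0 : left_id (qpi 0) qadd.
Proof. by move=> p; case: (qpiP p) => x ->; rewrite !qaddE add0r. Qed.
Fact qaddN : left_inverse (qpi 0) qopp qadd.
Proof. by move=> p; case: (qpiP p) => x ->; rewrite qoppE !qaddE addNr. Qed.

HB.instance Definition _ := GRing.isZmodule.Build (quo h) qaddA qaddC qadd0 qaddN.

Fact qscaleA a b p : qscale a (qscale b p) = qscale (a * b) p.
Proof. by case: (qpiP p) => x ->; rewrite !qscaleE scalerA. Qed.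
Fact qscale1 : left_id 1 qscale.
Proof. by move=> p; case: (qpiP p) => x ->; rewrite !qscaleE scale1r. Qed.
Fact qscaleDr : right_distributive qscale +%R.
Proof.
move=> a p q; case: (qpiP p) (qpiP q) => x -> [y ->].
by rewrite /+%R /= qaddE !qscaleE qaddE scalerDr.
Qed.
Fact qscaleDl p : {morph qscale^~ p : a b / a + b}.
Proof. by move=> a b; case: (qpiP p) => x ->; rewrite /+%R /= !qscaleE qaddE scalerDl. Qed.

HB.instance Definition _ :=
  GRing.Zmodule_isLmodule.Build A (quo h) qscaleA qscale1 qscaleDr qscaleDl.

Fact qpi_lin : linear qpi.
Proof. by move=> a x y; rewrite /+%R /*:%R /= qscaleE qaddE. Qed.

Lemma quo_ex : exists Q (p : {linear M -> Q}),
  surj p /\ forall y, p y = 0 <-> U y.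
Proof.
exists (quo h), (mklin qpi_lin); split=> [q|y].
  by case: (qpiP q) => x ->; exists x.
by rewrite (_ : 0 = qpi 0) // -[U y]/(U y) -{2}[y]subr0; exact: qpi_eq.
Qed.

End Quotient.

Definition ses X Y Z (j : {linear X -> Y}) (p : {linear Y -> Z}) : Prop :=
  [/\ injective j, surj p & forall y, p y = 0 <-> exists x, j x = y].

Lemma ses_pj X Y Z (j : {linear X -> Y}) (p : {linear Y -> Z}) x :
  ses j p -> p (j x) = 0.
Proof. by case=> _ _ h; apply/h; exists x. Qed.

Lemma lin_inj X Y (j : {linear X -> Y}) : (forall x, j x = 0 -> x = 0) -> injective j.
Proof.
move=> h x y e; apply/eqP; rewrite -subr_eq0; apply/eqP/h.
by rewrite linearB e subrr.
Qed.

Lemma inj_lin0 X Y (j : {linear X -> Y}) x : injective j -> j x = 0 -> x = 0.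
Proof. by move=> h e; apply: h; rewrite linear0. Qed.

Lemma ses_ker Y Z (p : {linear Y -> Z}) : surj p ->
  exists X (j : {linear X -> Y}), ses j p.
Proof.
move=> sp; have [X [j [ij hj]]] := sub_ex (sm_ker p).
by exists X, j.
Qed.

Lemma ses_coker X Y (j : {linear X -> Y}) : injective j ->
  exists Z (p : {linear Y -> Z}), ses j p.
Proof.
move=> ij; have [Z [p [sp hp]]] := quo_ex (sm_range j).
by exists Z, p.
Qed.

Lemma ses_sub M (U : M -> Prop) : submodule U ->
  exists N (j : {linear N -> M}) Q (p : {linear M -> Q}),
    ses j p /\ forall y, U y <-> exists x, j x = y.
Proof.
move=> h; have [N [j [ij hj]]] := sub_ex h.
by have [Q [p hp]] := ses_coker ij; exists N, j, Q, p.
Qed.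

Lemma factor_surj X Y Z (p : {linear X -> Y}) (f : {linear X -> Z}) :
  surj p -> (forall x, p x = 0 -> f x = 0) ->
  exists g : {linear Y -> Z}, forall x, g (p x) = f x.
Proof.
move=> sp hk.
have [||y [x [px <-]]|g hg] := @lin_of_rel Y Z (fun y z => exists x, p x = y /\ f x = z).
- by move=> y; have [x <-] := sp y; exists (f x), x.
- move=> a _ _ _ _ [x [<- <-]] [x' [<- <-]]; exists (a *: x + x').
  by rewrite !linearP.
- exact: hk.
- exists g => x; have [x' [e1 <-]] := hg (p x).
  by apply/eqP; rewrite -subr_eq0 -linearB; apply/eqP/hk; rewrite linearB e1 subrr.
Qed.

Lemma factor_inj X Y Z (j : {linear X -> Y}) (f : {linear Z -> Y}) :
  injective j -> (forall z, exists x, j x = f z) ->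
  exists g : {linear Z -> X}, forall z, j (g z) = f z.
Proof.
move=> ij hf; apply: (@lin_of_rel Z X (fun z x => j x = f z)) => //.
- by move=> a z x z' x' e e'; rewrite !linearP e e'.
- by move=> y; rewrite linear0; apply: inj_lin0.
Qed.

Lemma bij_inv X Y (f : {linear X -> Y}) : injective f -> surj f ->
  exists g : {linear Y -> X}, cancel f g /\ cancel g f.
Proof.
move=> fi fs; have [y|g hg] := factor_inj (f := idfun : {linear Y -> Y}) fi.
  exact: fs.
by exists g; split=> // x; apply: fi; rewrite hg.
Qed.

Lemma iso_modP X Y :
  iso_mod X Y <-> exists (f : {linear X -> Y}) (g : {linear Y -> X}),
    cancel f g /\ cancel g f.
Proof.
split=> [[f [g' fg gf]]|[f [g [fg gf]]]]; last by exists f, g.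
exists f; apply: bij_inv; first exact: can_inj fg.
by move=> y; exists (g' y).
Qed.

Lemma iso_surj X Y (f : {linear X -> Y}) : injective f -> surj f -> iso_mod X Y.
Proof. by move=> fi /(bij_inv fi)[g [? ?]]; exists f, g. Qed.

Lemma iso_refl X : iso_mod X X.
Proof. by exists (idfun : {linear X -> X}), id. Qed.

Lemma iso_sym X Y : iso_mod X Y -> iso_mod Y X.
Proof. by move=> /iso_modP[f [g [? ?]]]; exists g, f. Qed.

Lemma pullback X Y Z (f : {linear X -> Z}) (g : {linear Y -> Z}) :
  exists W (u : {linear W -> X}) (v : {linear W -> Y}),
    [/\ forall w, f (u w) = g (v w),
        forall x y, f x = g y -> exists w, u w = x /\ v w = y
      & forall w, u w = 0 -> v w = 0 -> w = 0].
Proof.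
have h : submodule (fun w : X * Y => f w.1 = g w.2).
  by split=> [|a x y /= e1 e2] /=; rewrite ?linear0 // !linearP e1 e2.
have [W [j [ij hj]]] := sub_ex h.
exists W, (fst \o j : {linear _ -> _}), (snd \o j : {linear _ -> _}); split=> /=.
- by move=> w; apply/hj; exists w.
- by move=> x y e; have /hj[w hw] : f (x, y).1 = g (x, y).2 by []; exists w; rewrite hw.
- by move=> w e1 e2; apply: (inj_lin0 ij); case: (j w) e1 e2 => /= ? ? -> ->.
Qed.

Lemma pullback_ses X Y Z M (j : {linear X -> Y}) (p : {linear Y -> Z})
    (f : {linear M -> Z}) : ses j p ->
  exists W (u : {linear W -> Y}) (i : {linear X -> W}) (q : {linear W -> M}),
    [/\ ses i q, forall w, p (u w) = f (q w), forall x, u (i x) = j x &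
        forall y m, p y = f m -> exists w, u w = y /\ q w = m].
Proof.
move=> h; have [ij sp kp] := h.
have [W [u [q [e1 e2 e3]]]] := pullback p f.
have [|||i hi] := @lin_of_rel X W (fun x w => u w = j x /\ q w = 0).
- by move=> x; have [|w [? ?]] := e2 (j x) 0; [rewrite linear0 (ses_pj _ h)|exists w].
- by move=> a x w x' w' [h1 h2] [h3 h4]; rewrite !linearP h1 h2 h3 h4 scaler0 addr0.
- by move=> w; rewrite linear0 => -[]; apply: e3.
exists W, u, i, q; split=> //; last by move=> x; case: (hi x).
split.
- apply: lin_inj => x ix; have [e _] := hi x; apply: (inj_lin0 ij).
  by rewrite -e ix linear0.
- by move=> m; have [y hy] := sp (f m); have [w [_ <-]] := e2 _ _ hy; exists w.
- move=> w; split=> [qw|[x <-]]; last by case: (hi x).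
  have /kp[x hx] : p (u w) = 0 by rewrite e1 qw linear0.
  exists x; have [e4 e5] := hi x; apply/eqP; rewrite -subr_eq0; apply/eqP/e3.
    by rewrite linearB e4 hx subrr.
  by rewrite linearB e5 qw subr0.
Qed.

Lemma pushout_ses X Y Z M (j : {linear X -> Y}) (p : {linear Y -> Z})
    (f : {linear X -> M}) : ses j p ->
  exists W (u : {linear Y -> W}) (i : {linear M -> W}) (q : {linear W -> Z}),
    [/\ ses i q, forall x, u (j x) = i (f x) & forall y, q (u y) = p y].
Proof.
move=> h; have [ij sp kp] := h.
have hU : submodule (fun w : M * Y => exists x, w = (f x, - j x)).
  split=> [|a w w' [x ->] [x' ->]]; first by exists 0; rewrite !linear0.
  exists (a *: x + x'); apply: injective_projections; rewrite /= linearP //.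
  by rewrite opprD scalerN.
have [W [t [st kt]]] := quo_ex hU.
have hi : linear (fun m : M => t (m, 0)).
  move=> a m m'; rewrite -linearP; congr (t _).
  by congr pair => /=; rewrite scaler0 addr0.
have hu : linear (fun y : Y => t (0, y)).
  move=> a m m'; rewrite -linearP; congr (t _).
  by congr pair => /=; rewrite scaler0 addr0.
have [|q hq] := factor_surj (f := p \o snd : {linear (M * Y)%type -> Z}) st.
  by move=> w /kt[x ->] /=; rewrite linearN (ses_pj _ h) oppr0.
exists W, (mklin hu), (mklin hi), q; split.
- split.
  + apply: lin_inj => m /kt[x [-> e]]; suff -> : x = 0 by rewrite linear0.
    by apply: (inj_lin0 ij); apply/eqP; rewrite -oppr_eq0 -e.
  + by move=> z; have [y <-] := sp z; exists (t (0, y)); rewrite hq.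
  + move=> w; split=> [|[m <-]]; last by rewrite [mklin _ _]/(t _) hq /= linear0.
    have [[m y] <-] := st w; rewrite hq /= => /kp[x <-].
    exists (m + f x); apply/eqP; rewrite [mklin _ _]/(t _) -subr_eq0 -linearB; apply/eqP/kt.
    by exists x; congr pair => /=; rewrite ?add0r // addrAC subrr add0r.
- move=> x; change (t (0, j x) = t (f x, 0)).
  apply/eqP; rewrite -subr_eq0 -linearB; apply/eqP/kt.
  by exists (- x); rewrite !linearN; congr pair => /=; rewrite ?sub0r ?subr0 ?opprK.
- by move=> y; rewrite hq.
Qed.

End Tools.

(** * Chain conditions and finite generation *)

Section ChainConditions.
Variable A : nzRingType.
Implicit Types M N Q X Y Z : lmodType A.

Definition leb_sub (b : bool) M (U V : M -> Prop) : Prop :=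
  if b then forall x, U x -> V x else forall x, V x -> U x.

(* The ascending ([b = true]) and descending ([b = false]) chain conditions, as
   the existence of extremal elements. *)
Definition chain_cond (b : bool) M : Prop :=
  forall S : (M -> Prop) -> Prop, (exists2 U, submodule U & S U) ->
  exists U, [/\ submodule U, S U & forall V, submodule V -> S V -> leb_sub b U V ->
                  forall x, U x <-> V x].

Lemma fin_zero b M : zero_mod M -> chain_cond b M.
Proof.
move=> hz S [U hU SU]; exists U; split=> // V hV _ _ x; rewrite (hz x).
by split=> _; [case: hV | case: hU].
Qed.

Lemma fin_surj b M N (p : {linear M -> N}) : surj p -> chain_cond b M -> chain_cond b N.
Proof.
move=> sp fM S [U hU SU].
have [|V [hV [V' [hV' SV' e]] mV]] :=
  fM (fun V => exists W, [/\ submodule W, S W & forall x, V x <-> W (p x)]).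
  by exists (fun x => U (p x)); [apply: sm_preim | exists U].
exists V'; split=> // W hW SW l y; have [x <-] := sp y.
have : V x <-> W (p x).
  apply: (mV (fun x => W (p x))); first exact: sm_preim.
    by exists W.
  by case: b l {fM mV} => /= l z; rewrite e; apply: l.
by rewrite e.
Qed.

Lemma fin_inj b M N (j : {linear N -> M}) : injective j -> chain_cond b M -> chain_cond b N.
Proof.
move=> ij fM S [U hU SU].
have [|V [hV [V' [hV' SV' e]] mV]] := fM (fun V => exists W, [/\ submodule W, S W &
   forall y, V y <-> exists2 x, W x & j x = y]).
  by exists (fun y => exists2 x, U x & j x = y); [apply: sm_im | exists U].
have imE (W : N -> Prop) x : (exists2 x', W x' & j x' = j x) <-> W x.
  by split=> [[x' ? /ij <-]|]; last exists x.
exists V'; split=> // W hW SW l x.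
have : V (j x) <-> exists2 x', W x' & j x' = j x.
  apply: (mV (fun y => exists2 x, W x & j x = y)); first exact: sm_im.
    by exists W.
  case: b l {fM mV} => /= l z; rewrite e => -[z' ? <-]; exists z' => //; exact: l.
by rewrite e !imE.
Qed.

(** Extremality is arranged in two stages: first for the trace on [X] of the members of [S], then
    for the image in [Z] among members with that trace. Comparable submodules with equal trace and
    equal image coincide by the modular law. *)
Lemma fin_ext b X Y Z (j : {linear X -> Y}) (p : {linear Y -> Z}) :
  ses j p -> chain_cond b X -> chain_cond b Z -> chain_cond b Y.
Proof.
move=> [ij sp kp] fX fZ S [U0 hU0 SU0].
have [|U1 [hU1 [V1 [hV1 SV1 e1]] m1]] := fX (fun U => exists V, [/\ submodule V, S V &
   forall x, U x <-> V (j x)]).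
  by exists (fun x => U0 (j x)); [apply: sm_preim | exists U0].
pose S2 W := exists V, [/\ submodule V, S V, forall x, U1 x <-> V (j x) &
   forall z, W z <-> exists2 y, V y & p y = z].
have [|W [hW [V2 [hV2 SV2 e2 e3]] m2]] := fZ S2.
  by exists (fun z => exists2 y, V1 y & p y = z); [apply: sm_im | exists V1].
exists V2; split=> // V hV SV l.
have eV x : U1 x <-> V (j x).
  apply: (m1 (fun x => V (j x))); [exact: sm_preim | by exists V |].
  by case: b l {fX fZ m1 m2} => /= l z; rewrite e2; apply: l.
have eW z : W z <-> exists2 y, V y & p y = z.
  apply: (m2 (fun z => exists2 y, V y & p y = z)); [exact: sm_im | by exists V |].
  by case: b l {fX fZ m1 m2} => /= l t; rewrite e3 => -[y vy <-]; exists y => //; apply: l.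
have modular (V' V'' : Y -> Prop) : submodule V' -> submodule V'' -> (forall y, V' y -> V'' y) ->
    (forall x, V'' (j x) -> V' (j x)) ->
    (forall z, (exists2 y, V'' y & p y = z) -> (exists2 y, V' y & p y = z)) ->
    forall y, V'' y -> V' y.
  move=> h' h'' s1 s2 s3 y vy.
  have [|y' vy' ep] := s3 (p y); first by exists y.
  have /kp[x ex] : p (y - y') = 0 by rewrite linearB ep subrr.
  rewrite -[y](subrK y'); apply: smD => //; rewrite -ex; apply: s2; rewrite ex.
  by apply: smB => //; apply: s1.
move=> y; split; case: b l {fX fZ m1 m2} => /= l; move: y => //; apply: modular => // z.
- by rewrite -e2 eV.
- by rewrite -e3 eW.
- by rewrite -e2 eV.
- by rewrite -e3 eW.
Qed.

Lemma ses_prod X Y : exists (j : {linear X -> (X * Y)%type}), ses j snd.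
Proof.
have h : linear (fun x : X => (x, 0 : Y)).
  by move=> a x x'; congr pair; rewrite /= scaler0 addr0.
exists (mklin h); split.
- by move=> x x' [].
- by move=> y; exists (0, y).
- by move=> [x y] /=; split=> [->|[x' [_ <-]]] //; exists x.
Qed.

Lemma fin_prod b X Y : chain_cond b X -> chain_cond b Y -> chain_cond b (X * Y)%type.
Proof. by move=> fX fY; have [j h] := ses_prod X Y; apply: (fin_ext h). Qed.

(** A one-sided inverse is enough, because chain conditions and the vanishing of Ext^1 pass to
    retracts; inductions on the exponent then peel off one factor. *)
Lemma ffun_retract X m : exists (i : {linear {ffun 'I_m.+1 -> X} -> (X * {ffun 'I_m -> X})%type})
    (r : {linear (X * {ffun 'I_m -> X})%type -> {ffun 'I_m.+1 -> X}}), cancel i r.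
Proof.
have hr : linear (fun w : X * {ffun 'I_m -> X} =>
    [ffun i : 'I_m.+1 => oapp w.2 w.1 (unlift ord0 i)]).
  move=> a w w'; apply/ffunP => i; rewrite !ffunE.
  by case: (unlift ord0 i) => [k|] //=; rewrite !ffunE.
have hi : linear (fun f : {ffun 'I_m.+1 -> X} => (f ord0, [ffun i : 'I_m => f (lift ord0 i)])).
  by move=> a f g; congr pair; rewrite ?ffunE //; apply/ffunP => i; rewrite !ffunE.
exists (mklin hi), (mklin hr) => f; apply/ffunP => i.
by rewrite [LHS]ffunE; case: unliftP => [k|] -> //=; rewrite ffunE.
Qed.

Lemma fin_ffun b X m : chain_cond b X -> chain_cond b {ffun 'I_m -> X}.
Proof.
move=> fX; elim: m => [|m IH]; first by apply: fin_zero => f; apply/ffunP => -[].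
have [i [r ir]] := ffun_retract X m.
by apply: (fin_surj (p := r)) (fin_prod fX IH) => f; exists (i f).
Qed.

(** If [P] fails for [M], choose a maximal kernel among the factor modules where it fails; all
    proper factors of that factor module satisfy [P]. *)
Lemma noeth_ind (P : lmodType A -> Prop) :
  (forall Q, chain_cond true Q ->
     (forall Q' (p : {linear Q -> Q'}), surj p -> (exists2 x, x <> 0 & p x = 0) -> P Q') ->
     P Q) ->
  forall M, chain_cond true M -> P M.
Proof.
move=> hP M fM; apply: contrapT => nP.
have [|U [hU [Q [p [sp kp nQ]]] mU]] := fM (fun U => exists Q (p : {linear M -> Q}),
   [/\ surj p, forall x, p x = 0 <-> U x & ~ P Q]).
  exists (fun x => x = 0); first exact: sm_zero.
  by exists M, idfun; split=> // x; exists x.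
apply: nQ; apply: hP => [|Q' p' sp' [x nx px]]; first exact: fin_surj fM.
apply: contrapT => nQ'; apply: nx; have [y ey] := sp x.
rewrite -ey; apply/kp/(mU (fun y => p' (p y) = 0)); last by rewrite ey.
- exact: sm_preim (sm_ker p').
- exists Q', (p' \o p : {linear _ -> _}); split=> // z.
  by have [t <-] := sp' z; have [w <-] := sp t; exists w.
- by move=> /= z /kp ->; rewrite linear0.
Qed.

Lemma simple_sub M : chain_cond false M -> ~ zero_mod M ->
  exists (S : lmodType A) (j : {linear S -> M}), simple_mod S /\ injective j.
Proof.
move=> fM nz.
have [|U [hU [x nx ux] mU]] := fM (fun U => exists2 x, x <> 0 & U x).
  exists (fun _ => True); first exact: sm_all.
  by apply: contrapT => h; apply: nz => x; apply: contrapT => nx; apply: h; exists x.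
have [S [j [ij hj]]] := sub_ex hU.
exists S, j; split=> //; split.
  by move=> hz; have /hj[s es] := ux; apply: nx; rewrite -es (hz s) linear0.
move=> V; case: (pselect (exists2 s, s <> 0 & s \in V)) => [[s ns sV]|h]; last first.
  left=> s sV; apply: contrapT => ns; apply: h; by exists s.
right=> s'; rewrite inE; apply/idP.
have hV := sm_im j (sm_mem V).
have /(mU _ hV)[||s'' h /ij <- //] : U (j s') by apply/hj; exists s'.
- exists (j s); last by exists s.
  by move=> e; apply: ns; apply: (inj_lin0 ij).
- by move=> /= _ [t _ <-]; apply/hj; exists t.
Qed.

Lemma fin_gen_surj M N (p : {linear M -> N}) : surj p -> fin_gen M -> fin_gen N.
Proof.
move=> sp [m [x hx]]; exists m, (fun i => p (x i)) => y.
have [z <-] := sp y; have [a ->] := hx z; exists a.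
by rewrite linear_sum; apply: eq_bigr => i _; rewrite linearZ.
Qed.

Definition free_mod m : lmodType A := {ffun 'I_m -> A^o}.
Definition unit_vec m (i : 'I_m) : free_mod m := [ffun k => (k == i)%:R].

Lemma free_basis m (f : free_mod m) : f = \sum_i (f i) *: unit_vec i.
Proof.
apply/ffunP => k; rewrite sum_ffunE (bigD1 k) //= big1 => [|i ik]; rewrite !ffunE.
  by rewrite eqxx addr0 /*:%R /= mulr1.
by rewrite eq_sym (negPf ik) /*:%R /= mulr0.
Qed.

Lemma free_map m N (x : 'I_m -> N) :
  exists p : {linear free_mod m -> N}, forall f, p f = \sum_i f i *: x i.
Proof.
have h : linear (fun f : free_mod m => \sum_i f i *: x i).
  move=> a f g; rewrite scaler_sumr -big_split; apply: eq_bigr => i _ /=.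
  by rewrite !ffunE scalerDl scalerA.
by exists (mklin h).
Qed.

Lemma free_map_unit m N (x : 'I_m -> N) :
  exists p : {linear free_mod m -> N}, forall i, p (unit_vec i) = x i.
Proof.
have [p hp] := free_map x; exists p => i.
rewrite hp (bigD1 i) //= big1 => [|k ki]; rewrite ffunE ?eqxx ?scale1r ?addr0 //.
by rewrite (negPf ki) scale0r.
Qed.

Lemma free_ext m N (f g : {linear free_mod m -> N}) :
  (forall i, f (unit_vec i) = g (unit_vec i)) -> forall x, f x = g x.
Proof.
move=> h x; rewrite [x]free_basis !linear_sum; apply: eq_bigr => i _.
by rewrite !linearZ_LR h.
Qed.

Lemma fin_gen_free m : fin_gen (free_mod m).
Proof. by exists m, (@unit_vec m) => f; exists f; exact: free_basis. Qed.

Lemma fin_genP M : fin_gen M <-> exists m (p : {linear free_mod m -> M}), surj p.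
Proof.
split=> [[m [x hx]]|[m [p sp]]]; last exact: fin_gen_surj sp (fin_gen_free m).
have [p hp] := free_map x; exists m, p => y; have [a ->] := hx y.
by exists [ffun i => a i]; rewrite hp; apply: eq_bigr => i _; rewrite ffunE.
Qed.

Lemma fin_gen_fin b M : chain_cond b A^o -> fin_gen M -> chain_cond b M.
Proof. by move=> fA /fin_genP[m [p sp]]; apply: (fin_surj sp); apply: fin_ffun. Qed.

Lemma fin_gen_zero M : zero_mod M -> fin_gen M.
Proof.
move=> hz; exists 0%N, (fun _ => 0) => y; exists (fun _ => 0).
by rewrite big_ord0 (hz y).
Qed.

Lemma free_lift m X Y (p : {linear X -> Y}) (f : {linear free_mod m -> Y}) :
  surj p -> exists h : {linear free_mod m -> X}, forall x, p (h x) = f x.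
Proof.
move=> sp; have /choice[x hx] : forall i, exists x, p x = f (unit_vec i) by move=> i; apply: sp.
have [h hh] := free_map_unit x; exists h.
by apply: (@free_ext _ _ (p \o h)) => i /=; rewrite hh hx.
Qed.

Lemma projective_free m : projective_mod (free_mod m).
Proof. by move=> X Y p f; apply: free_lift. Qed.

Lemma fin_gen_ext X Y Z (j : {linear X -> Y}) (p : {linear Y -> Z}) :
  ses j p -> fin_gen X -> fin_gen Z -> fin_gen Y.
Proof.
move=> [ij sp kp] /fin_genP[m [u su]] /fin_genP[m' [v sv]].
have [w hw] := free_lift v sp.
apply/fin_genP; exists (m + m')%N.
have [t ht] := free_map_unit (fun i : 'I_(m + m') =>
   match split i with inl k => j (u (unit_vec k)) | inr k => w (unit_vec k) end).
exists t => y; have [b hb] := sv (p y).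
have /kp[x hx] : p (y - w b) = 0 by rewrite linearB hw hb subrr.
have [a ha] := su x.
exists (\sum_i a i *: unit_vec (lshift m' i) + \sum_i b i *: unit_vec (rshift m i)).
rewrite linearD !linear_sum.
rewrite (eq_bigr (fun i => a i *: j (u (unit_vec i)))) => [|i _]; last first.
  by rewrite linearZ_LR ht (unsplitK (inl i)).
rewrite [X in _ + X](eq_bigr (fun i => b i *: w (unit_vec i))) => [|i _]; last first.
  by rewrite linearZ_LR ht (unsplitK (inr i)).
rewrite -(eq_bigr _ (fun i _ => linearZ_LR (j \o u : {linear _ -> _}) (a i) (unit_vec i))).
rewrite -(eq_bigr _ (fun i _ => linearZ_LR w (b i) (unit_vec i))).
by rewrite -!linear_sum -!free_basis /= ha hx subrK.
Qed.

(** A maximal finitely generated submodule contains every [y], since adjoining one generator keeps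
    it finitely generated. *)
Lemma noeth_fin_gen M : chain_cond true M -> fin_gen M.
Proof.
move=> fM; have [|U [hU [m [p hp]] mU]] := fM (fun U => exists m (p : {linear free_mod m -> M}),
    forall y, U y <-> exists x, p x = y).
  exists (fun x => x = 0); first exact: sm_zero.
  exists 0%N; have [p _] := @free_map_unit 0 M (fun _ => 0); exists p => y.
  split=> [->|[x <-]]; first by exists 0; rewrite linear0.
  by rewrite [x]free_basis big_ord0 linear0.
apply/fin_genP; exists m, p => y; apply/hp.
have [q hq] := @free_map_unit 1 M (fun _ => y).
have hV : submodule (fun y => exists2 u, U u & exists x, q x = y - u).
  exact: sm_add hU (sm_range q).
apply/(mU _ hV).
- exists (m + 1)%N; have [t ht] := free_map_unit (fun i : 'I_(m + 1) =>
    match split i with inl k => p (unit_vec k) | inr k => q (unit_vec k) end).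
  have tl a : t (\sum_i a i *: unit_vec (lshift 1 i)) = p (\sum_i a i *: unit_vec i).
    rewrite !linear_sum; apply: eq_bigr => i _.
    by rewrite !linearZ_LR ht (unsplitK (inl i)).
  have tr a : t (\sum_i a i *: unit_vec (rshift m i)) = q (\sum_i a i *: unit_vec i).
    rewrite !linear_sum; apply: eq_bigr => i _.
    by rewrite !linearZ_LR ht (unsplitK (inr i)).
  exists t => z; split=> [[u /hp[a <-] [b hb]]|[c <-]].
    exists (\sum_i a i *: unit_vec (lshift 1 i) + \sum_i b i *: unit_vec (rshift m i)).
    by rewrite linearD tl tr -!free_basis hb addrC subrK.
  exists (p (\sum_i c (lshift 1 i) *: unit_vec i)).
    by apply/hp; exists (\sum_i c (lshift 1 i) *: unit_vec i).
  exists (\sum_i c (rshift m i) *: unit_vec i).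
  rewrite -tl -tr (congr1 t (free_basis c)) big_split_ord /= linearD.
  by rewrite [X in _ = X - _]addrC addrK.
- by move=> /= x ux; exists x => //; exists 0; rewrite linear0 subrr.
- by exists 0; [case: hU | exists (unit_vec ord0); rewrite hq subr0].
Qed.

End ChainConditions.

(** * Modules over Artin algebras *)

Lemma artinian_fin (R : comNzRingType) : artinian_ring R -> chain_cond false R^o.
Proof.
move=> hR S [U0 hU0 SU0]; apply: contrapT => nomin.
have step (u : {U : R^o -> Prop | submodule U /\ S U}) :
    exists v : {U : R^o -> Prop | submodule U /\ S U},
      (forall x, sval v x -> sval u x) /\ exists2 x, sval u x & ~ sval v x.
  case: u => U [hU SU] /=; apply: contrapT => nv; apply: nomin.
  exists U; split=> // V hV SV /= l x; split=> [ux|]; last exact: l.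
  apply: contrapT => nvx; apply: nv; exists (exist _ V (conj hV SV)); split=> //.
  by exists x.
have [f hf] := choice step.
pose u k := iter k f (exist _ U0 (conj hU0 SU0)).
have hu k : submodule (sval (u k)) by case: (u k) => ? [].
have [k x|N hN] := hR (fun k => sub_of (hu k)).
  by move=> /sub_ofE h; apply/sub_ofE; case: (hf (u k)) => h1 _; apply: h1.
have [_ [x ux nx]] := hf (u N); apply: nx.
by apply/(sub_ofE (hu N.+1)); rewrite hN //; apply/sub_ofE.
Qed.

Section Commutative.
Variable R : comNzRingType.

Lemma scale_lin (I : lmodType R) (r : R) : linear (fun x : I => r *: x).
Proof. by move=> a x y; rewrite scalerDr !scalerA mulrC. Qed.

Lemma hyperplane (I : lmodType R) (x : I) : x <> 0 ->
  (forall (r : R) (y : I), r *: y <> 0 -> exists s, y = s *: (r *: y)) ->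
  exists W : I -> Prop, [/\ submodule W, ~ W x & forall y, exists2 w, W w & exists r, y = w + r *: x].
Proof.
move=> nx inv.
(* Membership of 0 is left out of [P], because the union of the empty chain has to satisfy [P]; for
   the maximal [W] it is recovered just below. *)
pose P := (fun U : I -> Prop => (forall a y z, U y -> U z -> U (a *: y + z)) /\ ~ U x).
have [F hF tF|W [[hW nW] mW]] := @classical_sets.Zorn_bigcup I P.
  split=> [a y z [U FU uy] [V FV vz]|[U /hF[_ h] ux]]; last exact: h.
  by case: (tF U V FU FV) => l; [exists V | exists U] => //;
     apply: (hF _ _).1 => //; apply: l.
have W0 : W 0.
  apply: contrapT => n0; apply: (mW (fun y => y = 0)).
    split=> [y wy|/(_ 0 erefl)] //.
    by case: n0; rewrite -(addNr y) -scaleN1r; exact: hW.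
  by split=> // a y z -> ->; rewrite scaler0 addr0.
have sW : submodule W by [].
exists W; split=> // y.
case: (pselect (W y)) => wy; first by exists y => //; exists 0; rewrite scale0r addr0.
pose V z := exists2 w, W w & exists r, z - w = r *: y.
have sV : submodule V.
  apply: (sm_add (V := fun t => exists r, t = r *: y) sW); split=> [|a _ _ [r ->] [r' ->]]; first by exists 0; rewrite scale0r.
  by exists (a * r + r'); rewrite scalerDl scalerA.
have [w Ww [r e]] : V x.
  apply: contrapT => nVx; apply: (mW V); last by split=> //; case: sV.
  split=> [z wz|/(_ y) h]; first by exists z => //; exists 0; rewrite subrr scale0r.
  by apply/wy/h; exists 0 => //; exists 1; rewrite subr0 scale1r.
have [ry|s ey] := inv r y.
  by apply: nW; rewrite -[x](subrK w) e ry add0r.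
exists (- s *: w); first exact: smZ.
by exists s; rewrite {1}ey -e scalerBr scaleNr addrC.
Qed.

(* A minimal non-Noetherian ideal would be a vector space over the residue
   field of its annihilator, hence would have a hyperplane, which is Noetherian. *)
Lemma art_noeth : chain_cond false R^o -> chain_cond true R^o.
Proof.
move=> fR; apply: contrapT => nfR.
have [|U [hU [I [j [ij hj nfI]]] mU]] := fR (fun U => exists (N : lmodType R) (j : {linear N -> R^o}),
    [/\ injective j, forall y, U y <-> exists x, j x = y & ~ chain_cond true N]).
  exists (fun _ => True); first exact: sm_all.
  by exists R^o, idfun; split=> [x y|y|] //; split=> // _; exists y.
have fI : chain_cond false I by apply: (fin_inj ij).
(* Minimality of [U]: a proper submodule of [I] is Noetherian. *)
have sub (N : lmodType R) (u : {linear N -> I}) : injective u -> chain_cond true N \/ surj u.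
  move=> iu; case: (pselect (chain_cond true N)) => nN; [by left | right=> y].
  have /(mU _ (sm_range (j \o u : {linear _ -> _})))[||x /= /ij] : U (j y).
  - by apply/hj; exists y.
  - exists N, (j \o u : {linear _ -> _}); split=> //.
    by apply: inj_comp.
  - by move=> /= _ [x <-]; apply/hj; exists (u x).
  - by exists x.
(* Kernel and image of multiplication by [r] are submodules of [I]. Were both proper, both would be
   Noetherian, and [I] with them. *)
have ann r : (forall x : I, r *: x = 0) \/ forall y : I, exists x, r *: x = y.
  pose m := mklin (@scale_lin I r).
  have [N1 [u1 [iu1 hu1]]] := sub_ex (sm_range m).
  case: (sub _ _ iu1) => [fN1|su1]; last by right=> y; apply/hu1.
  left; have [K [k [ik hk]]] := sub_ex (sm_ker m).
  case: (sub _ _ ik) => [fK|sk]; last by move=> x; apply/hk.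
  have [|q hq] := @factor_inj _ _ _ _ u1 m iu1.
    by move=> z; apply/hu1; exists z.
  case: nfI; apply: (@fin_ext _ true _ _ _ k q) => //; split=> //.
    move=> z; have /hu1[x ex] : exists z', u1 z' = u1 z by exists z.
    by exists x; apply: iu1; rewrite hq.
  move=> y; rewrite -hk -hq; split=> [->|]; first by rewrite linear0.
  by apply: inj_lin0.
(* Here [r] acts surjectively, as do its powers, and the descending ideals (r^k) become stationary:
   r^k = r^(k+1) s. Hence [s] inverts [r] on [I]. *)
have inv r (y : I) : r *: y <> 0 -> exists s, y = s *: (r *: y).
  move=> ry; have sr : forall y : I, exists x, r *: x = y by case: (ann r) => // /(_ y).
  have spow k : forall y : I, exists x, r ^+ k *: x = y.
    elim: k => [|k IH] z; first by exists z; rewrite expr0 scale1r.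
    have [z1 <-] := sr z; have [z2 <-] := IH z1.
    by exists z2; rewrite scalerA exprS.
  have [|V [hV [k hk] mV]] := fR (fun V => exists k, forall t, V t <-> exists s, t = r ^+ k * s).
    exists (fun t => exists s, t = r ^+ 0 * s); last by exists 0%N.
    split=> [|a x x' [s ->] [s' ->]]; first by exists 0; rewrite mulr0.
    by exists (a * s + s'); rewrite mulrDr mulrCA.
  have hV' : @submodule R R^o (fun t => exists s, t = r ^+ k.+1 * s).
    split=> [|a x x' [s ->] [s' ->]]; first by exists 0; rewrite mulr0.
    by exists (a * s + s'); rewrite mulrDr mulrCA.
  have /(mV _ hV')[||s es] : V (r ^+ k) by apply/hk; exists 1; rewrite mulr1.
  - by exists k.+1.
  - by move=> /= t [s ->]; apply/hk; exists (r * s); rewrite exprSr mulrA.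
  exists s; have [x <-] := spow k y; rewrite !scalerA -mulrA -exprS mulrC.
  by rewrite -es.
have [x nx] : exists x : I, x <> 0.
  apply: contrapT => h; apply: nfI; apply: fin_zero => x.
  by apply: contrapT => nx; apply: h; exists x.
have [W [hW nW spanW]] := hyperplane nx inv.
have [N [i [Q [q [hs hi]]]]] := ses_sub hW; have [ii sq kq] := hs.
apply: nfI; apply: (fin_ext hs).
  case: (sub _ _ ii) => // si; case: nW; apply/hi; exact: si.
(* The factor by the hyperplane is a line: a nonzero element is a multiple of the class of [x] by an
   invertibly acting scalar, so it generates everything. *)
have all (V : Q -> Prop) v : submodule V -> V v -> v <> 0 -> forall z, V z.
  move=> hV vv nv; have [y ey] := sq v; have [w Ww [r er]] := spanW y.
  have qw : q w = 0 by apply/kq/hi.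
  have ev : v = r *: q x by rewrite -ey er linearD qw add0r linearZ_LR.
  have rx : r *: x <> 0 by move=> rx; apply: nv; rewrite ev -linearZ_LR rx linear0.
  have [s es] := inv r x rx.
  have vx : V (q x) by rewrite es linearZ_LR linearZ_LR -ev; apply: smZ.
  move=> z; have [y' <-] := sq z; have [w' Ww' [r' ->]] := spanW y'.
  have qw' : q w' = 0 by apply/kq/hi.
  by rewrite linearD qw' add0r linearZ_LR; apply: smZ.
move=> S [V0 hV0 SV0].
case: (pselect (exists V, [/\ submodule V, S V & exists2 v, V v & v <> 0])) => [[V [hV SV [v vv nv]]]|h].
  exists V; split=> // V' hV' SV' l z; split=> _; first by apply: l; apply: (all _ v).
  exact: (all _ v).
exists V0; split=> // V hV SV l z; split=> [/l //|vz].
suff -> : z = 0 by case: hV0.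
by apply: contrapT => nz; apply: h; exists V; split=> //; exists z.
Qed.

End Commutative.

(** * Restriction of scalars to R, and finiteness of Hom *)

Section Restriction.
Variables (R : comNzRingType) (A : algType R).

Definition restr (M : lmodType A) : Type := M.

Section Instances.
Variable M : lmodType A.
HB.instance Definition _ := GRing.Zmodule.on (restr M).

Definition rscale (r : R) (x : restr M) : restr M := (r%:A : A) *: (x : M).

Fact rscaleA a b x : rscale a (rscale b x) = rscale (a * b) x.
Proof. by rewrite /rscale scalerA -scalerAl mul1r scalerA. Qed.
Fact rscale1 : left_id 1 rscale.
Proof. by move=> x; rewrite /rscale !scale1r. Qed.
Fact rscaleDr : right_distributive rscale +%R.
Proof. by move=> a x y; rewrite /rscale scalerDr. Qed.
Fact rscaleDl x : {morph rscale^~ x : a b / a + b}.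
Proof. by move=> a b; rewrite /rscale !scalerDl. Qed.

HB.instance Definition _ :=
  GRing.Zmodule_isLmodule.Build R (restr M) rscaleA rscale1 rscaleDr rscaleDl.
End Instances.

Definition Rmod (M : lmodType A) : lmodType R := restr M.

Lemma rscaleE (M : lmodType A) (r : R) (x : Rmod M) : r *: x = (r%:A : A) *: (x : M).
Proof. by []. Qed.

Lemma restr_lin (M N : lmodType A) (f : {linear M -> N}) :
  linear (f : Rmod M -> Rmod N).
Proof. by move=> a x y; rewrite !rscaleE linearP. Qed.

Lemma fin_restr b (M : lmodType A) : chain_cond b (Rmod M) -> chain_cond b M.
Proof.
move=> fM S [U hU SU].
have smR (V : M -> Prop) : submodule V -> @submodule R (Rmod M) V.
  by case=> v0 h; split=> // a x y vx vy; rewrite rscaleE; apply: h.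
have [|V [hV [SV hV'] mV]] := fM (fun V => S V /\ @submodule A M V).
  by exists U; first exact: smR.
by exists V; split=> // V' hV1 SV1 l; apply: mV => //; apply: smR.
Qed.

Lemma fin_gen_restr b (M : lmodType A) : chain_cond b (Rmod A^o) -> fin_gen M -> chain_cond b (Rmod M).
Proof.
move=> fA /fin_genP[m [p sp]].
apply: (@fin_surj _ _ _ _ (mklin (restr_lin p))) => //.
have h : linear (idfun : {ffun 'I_m -> Rmod A^o} -> Rmod (free_mod A m)).
  by move=> a f g; apply/ffunP => i; rewrite !ffunE.
apply: (@fin_surj _ _ _ _ (mklin h)); last exact: fin_ffun.
by move=> f; exists f.
Qed.

Hypothesis hA : artin_algebra A.

Lemma artin_fin_R b (M : lmodType A) : fin_gen M -> chain_cond b (Rmod M).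
Proof.
apply: fin_gen_restr; have [hR fA] := hA.
have fR : chain_cond b R^o.
  by case: b; [apply: art_noeth|]; apply: artinian_fin.
have /(fin_gen_fin fR) := fA.
have h : linear (idfun : (A : lmodType R) -> Rmod A^o).
  by move=> a x y; rewrite rscaleE /*:%R /= -scalerAl mul1r.
by apply: (@fin_surj _ _ _ _ (mklin h)) => x; exists x.
Qed.

Lemma artin_fin b (M : lmodType A) : fin_gen M -> chain_cond b M.
Proof. by move=> fM; apply: fin_restr; apply: artin_fin_R. Qed.

(** Evaluation at generators of [M] embeds Hom(M, N) into a power of [N], a Noetherian R-module. The
    coefficients are images of scalars of R; recording them as central elements of A makes the
    combinations A-linear and lets R disappear from the later arguments. *)
Lemma artin_hom (M N : lmodType A) : fin_gen M -> fin_gen N ->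
  exists m (f : 'I_m -> {linear M -> N}), forall g : {linear M -> N},
    exists c : 'I_m -> A, (forall i a, a * c i = c i * a) /\
      forall x, g x = \sum_i c i *: f i x.
Proof.
move=> [k [x hx]] fN.
have fV : chain_cond true {ffun 'I_k -> Rmod N} by apply: fin_ffun; apply: artin_fin_R.
pose ev (g : {linear M -> N}) : {ffun 'I_k -> Rmod N} := [ffun i => g (x i)].
have [|U [hU [m [f hf]] mU]] := fV (fun U => exists m (f : 'I_m -> {linear M -> N}),
    forall v, U v <-> exists c : 'I_m -> R, v = \sum_i c i *: ev (f i)).
  exists (fun v => v = 0); first exact: sm_zero.
  exists 0%N, (fun i => \0 : {linear M -> N}) => v; split=> [->|[c ->]]; last by rewrite big_ord0.
  by exists (fun _ => 0); rewrite big_ord0.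
exists m, f => g.
have [c hc] : exists c : 'I_m -> R, ev g = \sum_i c i *: ev (f i).
  apply/hf; have [p hp] := @free_map R 1 _ (fun _ => ev g).
  have hp1 v : p v = v ord0 *: ev g by rewrite hp big_ord1.
  have hV := sm_add hU (sm_range p).
  apply/(mU _ hV).
  - exists m.+1, (fun i => oapp f g (unlift ord0 i)) => v; split.
      move=> [u /hf[c ->] [z]]; rewrite hp1 => e.
      exists (fun i => oapp c (z ord0) (unlift ord0 i)).
      rewrite big_ord_recl unlift_none /= e -[LHS](subrK (\sum_(i < m) c i *: ev (f i))).
      by congr (_ + _); apply: eq_bigr => i _; rewrite liftK.
    move=> [c ->]; exists (\sum_i c (lift ord0 i) *: ev (f i)).
      by apply/hf; exists (fun i => c (lift ord0 i)).
    exists (c ord0 *: unit_vec R ord0).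
    rewrite hp1 !ffunE /*:%R /= mulr1 big_ord_recl unlift_none /=.
    rewrite (eq_bigr (fun i => c (lift ord0 i) *: ev (f i))) ?addrK // => i _.
    by rewrite liftK.
  - by move=> /= u uu; exists u => //; exists 0; rewrite linear0 subrr.
  - exists 0; first by case: hU.
    by exists (unit_vec R ord0); rewrite hp1 subr0 ffunE eqxx scale1r.
exists (fun i => (c i)%:A); split=> [i a|y].
  by rewrite -scalerAl -scalerAr mulr1 mul1r.
have [a ->] := hx y.
rewrite linear_sum; under [RHS]eq_bigr => i _ do rewrite linear_sum scaler_sumr.
rewrite exchange_big; apply: eq_bigr => l _ /=.
have := congr1 (fun v : {ffun _ -> _} => v l) hc.
rewrite ffunE sum_ffunE linearZ_LR => ->; rewrite scaler_sumr.
apply: eq_bigr => i _; rewrite !ffunE rscaleE linearZ_LR !scalerA.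
by rewrite -scalerAr -scalerAl mulr1 mul1r.
Qed.

End Restriction.

(** * Vanishing of Ext *)

Section Orth.
Variable A : nzRingType.
Implicit Types D K M N P Q W X Y Z : lmodType A.

(* Ext^1(X, Y) = 0. *)
Definition orth X Y : Prop :=
  forall K M (j : {linear K -> M}) (p : {linear M -> X}), ses j p ->
  forall f : {linear K -> Y}, exists g : {linear M -> Y}, forall x, g (j x) = f x.

(** Any extension of [X] is a pushout of the projective presentation along some K -> K', so it
    suffices to extend maps from the one kernel [K] to [P]. *)
Lemma orth_pres K P X Y (j : {linear K -> P}) (p : {linear P -> X}) :
  ses j p -> projective_mod P ->
  (forall f : {linear K -> Y}, exists g : {linear P -> Y}, forall x, g (j x) = f x) ->
  orth X Y.
Proof.
move=> h prP ext K' M j' p' h' f.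
have [ij sp kp] := h; have [ij' sp' kp'] := h'.
have [t ht] := prP _ _ p' p sp'.
have [|t0 ht0] := @factor_inj _ _ _ _ j' (t \o j : {linear _ -> _}) ij'.
  by move=> x /=; apply/kp'; rewrite ht (ses_pj _ h).
have [g0 hg0] := ext (f \o t0 : {linear _ -> _}).
(* [M] is the sum of the images of K' and [P], which overlap along [K]; [g] is [f] on the first and
   [g0] on the second, and they agree on the overlap by the choice of [g0]. *)
have [|||g hg] := @lin_of_rel _ M Y (fun m y => exists x z, m = j' x + t z /\ y = f x + g0 z).
- move=> m; have [z ez] := sp (p' m).
  have /kp'[x ex] : p' (m - t z) = 0 by rewrite linearB ht ez subrr.
  by exists (f x + g0 z), x, z; rewrite ex subrK.
- move=> a _ _ _ _ [x [z [-> ->]]] [x' [z' [-> ->]]].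
  exists (a *: x + x'), (a *: z + z'); rewrite !linearP.
  by rewrite !scalerDr; split; rewrite addrACA.
- move=> y [x [z [e ->]]].
  have /kp[k ek] : p z = 0.
    by have := congr1 p' e; rewrite linear0 linearD (ses_pj _ h') ht add0r.
  have ex : x = - t0 k.
    by apply: ij'; apply/eqP; rewrite linearN ht0 /= ek -addr_eq0 -e.
  by rewrite ex -ek hg0 linearN /= addNr.
- exists g => x; have [x' [z [e ->]]] := hg (j' x).
  have /kp[k ek] : p z = 0.
    by have := congr1 p' e; rewrite linearD !(ses_pj _ h') ht add0r.
  have ex : x = x' + t0 k by apply: ij'; rewrite linearD ht0 /= ek.
  by rewrite ex -ek hg0 linearD.
Qed.

Lemma orth_zero X Y : zero_mod X -> orth X Y.
Proof.
move=> hz K M j p [ij sp kp] f.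
have [|g [h1 h2]] := bij_inv ij; first by move=> y; apply/kp; apply: hz.
by exists (f \o g : {linear _ -> _}) => x /=; rewrite h1.
Qed.

Lemma orth_proj X Y : projective_mod X -> orth X Y.
Proof.
move=> prX K M j p [ij sp kp] f.
have [s hs] := prX _ _ p idfun sp.
have [|r hr] := @factor_inj _ _ _ _ j (idfun \- (s \o p) : {linear M -> M}) ij.
  by move=> m /=; apply/kp; rewrite linearB hs subrr.
exists (f \o r : {linear _ -> _}) => x /=; congr (f _); apply: ij.
rewrite hr /=; have -> : p (j x) = 0 by apply/kp; exists x.
by rewrite linear0 subr0.
Qed.

Lemma orth_inj X Y : injective_mod Y -> orth X Y.
Proof. by move=> iY K M j p [ij _ _] f; apply: iY. Qed.

(** The extension of [X] is pulled back along [r] to one of X'. Since [r] undoes [i], its middle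
    term [M] maps back into the pullback, sending m to the pair (m, i (p m)). *)
Lemma orth_retract X X' Y (i : {linear X -> X'}) (r : {linear X' -> X}) :
  cancel i r -> orth X' Y -> orth X Y.
Proof.
move=> ir hX K M j p h f.
have [W [u [i0 [q [h' e1 e2 e3]]]]] := pullback_ses r h.
have [g hg] := hX _ _ _ _ h' f.
have [ij0 sq kq] := h'; have [ij sp kp] := h.
have uq w : u w = 0 -> q w = 0 -> w = 0.
  move=> uw /kq[x ex]; rewrite -ex e2 in uw; rewrite -ex (inj_lin0 ij uw) linear0 //.
have [|||s hs] := @lin_of_rel _ M W (fun m w => u w = m /\ q w = i (p m)).
- by move=> m; apply: e3; rewrite ir.
- by move=> a m w m' w' [h1 h2] [h3 h4]; rewrite !linearP h1 h2 h3 h4.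
- by move=> w []; rewrite !linear0; apply: uq.
exists (g \o s : {linear _ -> _}) => x /=; rewrite -hg; congr (g _).
have [h1 h2] := hs (j x).
apply/eqP; rewrite -subr_eq0; apply/eqP/uq; rewrite linearB.
  by rewrite h1 e2 subrr.
by rewrite h2 !(ses_pj _ h) (ses_pj _ h') linear0 subrr.
Qed.

Lemma ses_preim X Y Z Z' N (j : {linear X -> Y}) (p : {linear Y -> Z})
    (i : {linear Z' -> Z}) (q : {linear Z -> N}) : ses j p -> ses i q ->
  exists Y' (u : {linear Y' -> Y}) (j' : {linear X -> Y'}) (p' : {linear Y' -> Z'}),
    [/\ ses j' p', ses u (q \o p : {linear _ -> _}), forall x, u (j' x) = j x
      & forall y, i (p' y) = p (u y)].
Proof.
move=> [ij sp kp] [ii sq kq].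
have [Y' [u [iu hu]]] := sub_ex (sm_ker (q \o p : {linear _ -> _})).
have [|j' hj'] := @factor_inj _ _ _ _ u j iu.
  by move=> x; apply/hu; rewrite /= (iffRL (kp _)) ?linear0 //; exists x.
have [|p' hp'] := @factor_inj _ _ _ _ i (p \o u : {linear _ -> _}) ii.
  by move=> m /=; apply/kq; apply/hu; exists m.
exists Y', u, j', p'; split=> //; last first.
  by split=> // n; have [z <-] := sq n; have [y <-] := sp z; exists y.
split.
- by move=> x y e; apply: ij; rewrite -!hj' e.
- move=> z'; have [y ey] := sp (i z').
  have /hu[y' ey'] : (q \o p : {linear _ -> _}) y = 0.
    by rewrite /= ey; apply/kq; exists z'.
  by exists y'; apply: ii; rewrite hp' /= ey'.
- move=> y; split=> [e|[x <-]].
    have /kp[x ex] : p (u y) = 0 by have := hp' y; rewrite e linear0.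
    by exists x; apply: iu; rewrite hj'.
  by apply: ii; rewrite hp' /= hj' linear0; apply/kp; exists x.
Qed.

Lemma orth_ext X' X X'' Y (j : {linear X' -> X}) (p : {linear X -> X''}) :
  ses j p -> orth X' Y -> orth X'' Y -> orth X Y.
Proof.
move=> h h' h'' K M jK pM hM f.
have [M' [u [jK' [pM' [h1 h2 e1 _]]]]] := ses_preim hM h.
have [g hg] := h' _ _ _ _ h1 f; have [t ht] := h'' _ _ _ _ h2 g.
by exists t => x; rewrite -e1 ht hg.
Qed.

(** This is exactness of Hom(X', Y) -> Ext^1(X'', Y) -> Ext^1(X, Y). The pullback extends [f], and
    the extension descends to [M] because it vanishes on the copy of X' that is the kernel of
    [u]. *)
Lemma orth_quot X' X X'' Y (j : {linear X' -> X}) (p : {linear X -> X''}) :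
  ses j p -> (forall (f : {linear X' -> Y}) x, f x = 0) -> orth X Y -> orth X'' Y.
Proof.
move=> [ij sp kp] h0 hX K M jK pM h f.
have [W [u [i0 [q [h' e1 e2 e3]]]]] := pullback_ses p h.
have [g hg] := hX _ _ _ _ h' f.
have [ij0 sq kq] := h'; have [ijK spM kpM] := h.
have [K' [k [ik hk]]] := sub_ex (sm_ker u).
have [|t ht] := @factor_inj _ _ _ _ j (q \o k : {linear _ -> _}) ij.
  move=> x; apply/kp => /=; rewrite -e1.
  by rewrite (iffRL (hk _)) ?linear0 //; exists x.
have ti : injective t.
  apply: lin_inj => x tx; apply: (inj_lin0 ik).
  have /kq[y ey] : q (k x) = 0 by rewrite -[q _]/((q \o k) x) -ht tx linear0.
  have : u (k x) = 0 by apply/hk; exists x.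
  by rewrite -ey e2 => /(inj_lin0 ijK) ->; rewrite linear0.
have ts : surj t.
  move=> x; have [|w [uw qw]] := e3 0 (j x).
    by rewrite linear0; apply/esym/kp; exists x.
  have /hk[z ez] := uw; exists z; apply: ij.
  by rewrite ht /= ez.
have [t' [tt' t't]] := bij_inv ti ts.
have gk z : g (k z) = 0.
  by rewrite -[z]tt'; apply: (h0 (g \o k \o t' : {linear _ -> _})).
have [||r hr] := factor_surj (p := u) (f := g).
- by move=> m; have [x ex] := sp (pM m); have [w [<- _]] := e3 _ _ (esym ex); exists w.
- by move=> w uw; have /hk[z <-] := uw.
by exists r => x; rewrite -e2 hr hg.
Qed.

Lemma orth_ext_r K P X Y' Y Y'' (jK : {linear K -> P}) (pX : {linear P -> X})
    (j : {linear Y' -> Y}) (p : {linear Y -> Y''}) :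
  ses jK pX -> projective_mod P -> ses j p -> orth X Y' -> orth X Y'' -> orth X Y.
Proof.
move=> hX prP [ij sp kp] h' h''; apply: (orth_pres hX prP) => f.
have [g'' hg''] := h'' _ _ _ _ hX (p \o f : {linear _ -> _}).
have [g hg] := prP _ _ p g'' sp.
have [|f' hf'] := @factor_inj _ _ _ _ j (f \- (g \o jK) : {linear K -> Y}) ij.
  by move=> x /=; apply/kp; rewrite linearB hg hg'' subrr.
have [g' hg'] := h' _ _ _ _ hX f'.
exists ((j \o g') \+ g : {linear P -> Y}) => x /=.
by rewrite hg' hf' /= subrK.
Qed.

(** The obstruction to lifting [f] is the pullback extension of [K] by Y', which splits. *)
Lemma orth_lift K Y' Y Y'' (j : {linear Y' -> Y}) (p : {linear Y -> Y''}) :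
  ses j p -> orth K Y' -> forall f : {linear K -> Y''},
  exists g : {linear K -> Y}, forall x, p (g x) = f x.
Proof.
move=> h hK f; have [W [u [i [q [h' e1 e2 e3]]]]] := pullback_ses f h.
have [r hr] := hK _ _ _ _ h' idfun; have [_ sq kq] := h'.
have [|g hg] := factor_surj (f := u \- (j \o r) : {linear W -> Y}) sq.
  by move=> w /kq[y <-] /=; rewrite e2 hr subrr.
exists g => x; have [w <-] := sq x.
by rewrite hg /= linearB (ses_pj _ h) subr0.
Qed.

(** Exactness of Ext^1(X, Y) -> Ext^1(X, Y'') -> Ext^2(X, Y'), with Ext^2(X, Y') written as Ext^1(K,
    Y'). *)
Lemma orth_coker K P X Y' Y Y'' (jK : {linear K -> P}) (pX : {linear P -> X})
    (j : {linear Y' -> Y}) (p : {linear Y -> Y''}) :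
  ses jK pX -> projective_mod P -> ses j p -> orth K Y' -> orth X Y -> orth X Y''.
Proof.
move=> hX prP h h' hY; apply: (orth_pres hX prP) => f.
have [g hg] := orth_lift h h' f.
have [t ht] := hY _ _ _ _ hX g.
by exists (p \o t : {linear _ -> _}) => x /=; rewrite ht hg.
Qed.

(** Exactness of Ext^1(D, X') -> Ext^2(D, X) -> Ext^2(D, Y), with Ext^2(D, -) written as Ext^1(K,
    -). *)
Lemma orth_syzygy K P D X Y X' (jK : {linear K -> P}) (pD : {linear P -> D})
    (i : {linear X -> Y}) (q : {linear Y -> X'}) :
  ses jK pD -> projective_mod P -> ses i q -> orth K Y -> orth D X' -> orth K X.
Proof.
move=> hD prP hX hK hX' K' M j' p' h' f.
have [ii sq kq] := hX; have [ij' sp' kp'] := h'.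
have [g hg] := hK _ _ _ _ h' (i \o f : {linear _ -> _}).
have [|h hh] := factor_surj (f := q \o g : {linear _ -> _}) sp'.
  by move=> m /kp'[x <-] /=; rewrite hg (ses_pj _ hX).
have [h1 hh1] := hX' _ _ _ _ hD h.
have [h2 hh2] := prP _ _ q h1 sq.
have [|g' hg'] := @factor_inj _ _ _ _ i (g \- (h2 \o jK \o p') : {linear M -> Y}) ii.
  by move=> m /=; apply/kq; rewrite linearB hh2 hh1 hh subrr.
exists g' => x; apply: ii; rewrite hg' /= hg (ses_pj _ h').
by rewrite !linear0 addr0.
Qed.

Lemma orth_free X Y m : orth X Y -> orth X {ffun 'I_m -> Y}.
Proof.
move=> hX K M j p h f.
have pr (i : 'I_m) : linear (fun v : {ffun 'I_m -> Y} => v i).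
  by move=> a v v'; rewrite !ffunE.
have /choice[g hg] : forall i : 'I_m, exists g : {linear M -> Y}, forall x, g (j x) = f x i.
  by move=> i; apply: (hX _ _ _ _ h (mklin (pr i) \o f : {linear _ -> _})).
have lg : linear (fun x : M => [ffun i => g i x]).
  by move=> a x y; apply/ffunP => i; rewrite !ffunE linearP.
by exists (mklin lg) => x; apply/ffunP => i; rewrite ffunE hg.
Qed.

Lemma orth_pow X Y m : orth X Y -> orth {ffun 'I_m -> X} Y.
Proof.
move=> oX; elim: m => [|m IH]; first by apply: orth_zero => f; apply/ffunP => -[].
have [i [r ir]] := ffun_retract X m; apply: orth_retract ir _.
by have [j h] := ses_prod X {ffun 'I_m -> X}; apply: orth_ext h oX IH.
Qed.

Lemma proj_retract P Q (i : {linear P -> Q}) (r : {linear Q -> P}) :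
  cancel i r -> projective_mod Q -> projective_mod P.
Proof.
move=> ir prQ X Y p f sp; have [h hh] := prQ _ _ p (f \o r : {linear _ -> _}) sp.
by exists (h \o i : {linear _ -> _}) => x /=; rewrite hh /= ir.
Qed.

Lemma free_pres X : fin_gen X -> exists K m (j : {linear K -> free_mod A m}) p, @ses A K (free_mod A m) X j p.
Proof.
move=> /fin_genP[m [p sp]]; have [K [j h]] := ses_ker sp.
by exists K, m, j, p.
Qed.

Lemma injective_prod X Y : injective_mod X -> injective_mod Y -> injective_mod (X * Y)%type.
Proof.
move=> hX hY M N j f ij.
have [g hg] := hX _ _ j (fst \o f : {linear _ -> _}) ij.
have [g' hg'] := hY _ _ j (snd \o f : {linear _ -> _}) ij.
have h : linear (fun x : N => (g x, g' x)) by move=> a x y; rewrite !linearP.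
exists (mklin h) => x; change ((g (j x), g' (j x)) = f x).
by rewrite hg hg' /=; case: (f x).
Qed.

(** Pushing the second sequence out along [p] realises Z/X as an extension of Z/Y by Y/X. Cokernels
    of composed embeddings thereby stay filtered. *)
Lemma ses_comp X Y Z D D' (j : {linear X -> Y}) (p : {linear Y -> D})
    (j' : {linear Y -> Z}) (p' : {linear Z -> D'}) : ses j p -> ses j' p' ->
  exists W (q : {linear Z -> W}) (i : {linear D -> W}) (r : {linear W -> D'}),
    ses (j' \o j) q /\ ses i r.
Proof.
move=> [ij sp kp] h'; have [ij' sp' kp'] := h'.
have [W [u [i [q [h e1 e2]]]]] := pushout_ses p h'.
exists W, u, i, q; split=> //; split.
- exact: inj_comp.
- have [ii sq kq] := h; move=> w; have [z ez] := sp' (q w).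
  have /kq[d ed] : q (w - u z) = 0 by rewrite linearB e2 ez subrr.
  have [y ey] := sp d; exists (z + j' y).
  by rewrite linearD e1 ey ed addrC subrK.
- have [ii sq kq] := h; move=> z; split=> [uz|[x <-] /=]; last first.
    by rewrite e1 (iffRL (kp _)) ?linear0 //; exists x.
  have /kp'[y ey] : p' z = 0 by rewrite -e2 uz linear0.
  have /kp[x ex] : p y = 0 by apply: (inj_lin0 ii); rewrite -e1 ey.
  by exists x; rewrite /= ex.
Qed.

End Orth.

(** * Filtrations and resolutions *)

Section Filtrations.
Variable A : nzRingType.
Implicit Types D K M N P Q W X Y Z : lmodType A.

Lemma ses_iso_mid X Y Y' Z (j : {linear X -> Y}) (p : {linear Y -> Z})
    (f : {linear Y -> Y'}) (g : {linear Y' -> Y}) : cancel f g -> cancel g f ->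
  ses j p -> ses (f \o j : {linear _ -> _}) (p \o g : {linear _ -> _}).
Proof.
move=> fg gf [ij sp kp]; split.
- by apply: inj_comp => //; apply: can_inj fg.
- by move=> z; have [y <-] := sp z; exists (f y) => /=; rewrite fg.
- move=> y /=; rewrite kp; split=> -[x]; first by move=> ex; exists x; rewrite ex gf.
  by move=> <-; exists x; rewrite fg.
Qed.

Lemma ses_iso_r X Y Z Z' (j : {linear X -> Y}) (p : {linear Y -> Z})
    (f : {linear Z -> Z'}) : injective f -> surj f ->
  ses j p -> ses j (f \o p : {linear _ -> _}).
Proof.
move=> fi fs [ij sp kp]; split=> //.
- by move=> z; have [y <-] := fs z; have [x <-] := sp y; exists x.
- move=> y /=; rewrite -kp; split=> [|->]; last by rewrite linear0.
  exact: inj_lin0.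
Qed.

(** One inductive form serves two notions: weight 0 gives [filtered], and the indicator of being
    isomorphic to E(i) gives [comp_mult]. Each step adds the top factor. *)
Inductive wfilt (w : lmodType A -> nat) (Theta : lmodType A -> Prop) :
    nat -> lmodType A -> Prop :=
| WfiltZero M : zero_mod M -> wfilt w Theta 0 M
| WfiltStep r M' M N (j : {linear M' -> M}) (p : {linear M -> N}) :
    ses j p -> Theta N -> wfilt w Theta r M' -> wfilt w Theta (r + w N) M.

Section Wfilt.
Variables (w : lmodType A -> nat) (Theta : lmodType A -> Prop).

Lemma zero_iso M M' : iso_mod M M' -> zero_mod M -> zero_mod M'.
Proof. by move=> /iso_modP[f [g [fg gf]]] hz y; rewrite -[y]gf (hz (g y)) linear0. Qed.

Lemma wfilt_iso r M M' : iso_mod M M' -> wfilt w Theta r M -> wfilt w Theta r M'.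
Proof.
move=> + h; case: h => [{}M hz /zero_iso|{}r L {}M N j p h hN hL].
  by move=> /(_ hz); apply: WfiltZero.
move=> /iso_modP[f [g [fg gf]]].
exact: WfiltStep (ses_iso_mid fg gf h) hN hL.
Qed.

Lemma ses_zero_r X Y Z (j : {linear X -> Y}) (p : {linear Y -> Z}) :
  ses j p -> zero_mod Z -> iso_mod X Y.
Proof.
by move=> [ij sp kp] hz; apply: (iso_surj ij) => y; apply/kp; apply: hz.
Qed.

Lemma wfilt_ext r r' X Y Z (j : {linear X -> Y}) (p : {linear Y -> Z}) :
  ses j p -> wfilt w Theta r X -> wfilt w Theta r' Z -> wfilt w Theta (r + r') Y.
Proof.
move=> h hX hZ; elim: hZ Y j p h => [{}Z hz|{}r' Z' {}Z N i q hi hN hZ' IH] Y j p h.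
  by rewrite addn0; apply: wfilt_iso hX; apply: ses_zero_r h hz.
have [Y' [u [j' [p' [h1 h2 _ _]]]]] := ses_preim h hi.
by rewrite addnA; apply: WfiltStep h2 hN (IH _ _ _ h1).
Qed.

Lemma is_factorP M (U V : submodClosed M) N K (u : {linear K -> M}) (g : {linear K -> N}) :
  injective u -> (forall y, y \in U <-> exists x, u x = y) -> surj g ->
  (forall x, g x = 0 <-> u x \in V) -> {subset V <= U} -> is_factor U V N.
Proof.
move=> iu hu sg kg VU; split=> //.
have [|t ht] := @factor_inj _ _ _ _ u (subval U) iu.
  by move=> x; apply/hu; exact: submod_valP.
exists (g \o t : {linear _ -> _}); split=> [n|x] /=.
  have [k ek] := sg n; have /subval_im[x ex] : u k \in U by apply/hu; exists k.
  by exists x; rewrite -ek /=; congr (g _); apply: iu; rewrite ht.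
by rewrite kg ht.
Qed.

Lemma wfiltP r M : wfilt w Theta r M <->
  exists m (U : nat -> submodClosed M) (N : nat -> lmodType A),
    [/\ filtration m U N, forall k, (k < m)%N -> Theta (N k)
      & (\sum_(k < m) w (N k))%N = r].
Proof.
split=> [|[m [U [N [[U0 Um fac] hT <-]]]]].
  elim=> {r M} [M hz|r M' M N j p h hN _ [m [U' [N' [[U0 Um fac] hT <-]]]]].
    exists 0%N, (fun _ => sub_of (sm_zero M)), (fun _ => M).
    rewrite big_ord0; split=> //; split=> // x; first by rewrite sub_ofE.
    by apply/idP; apply/sub_ofE; apply: hz.
  have [ij sp kp] := h.
  pose U k := if (k <= m)%N then sub_of (sm_im j (sm_mem (U' k))) else sub_of (sm_all M).
  pose Nk k := if (k < m)%N then N' k else N.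
  exists m.+1, U, Nk; split; last first.
  - rewrite big_ord_recr /= {2}/Nk ltnn; congr (_ + _)%N.
    by apply: eq_bigr => i _; rewrite /Nk ltn_ord.
  - by move=> k _; rewrite /Nk; case: ifP => // /hT.
  split.
  - move=> x; rewrite /U leq0n sub_ofE; split=> [[y /U0 -> <-]|->].
      by rewrite linear0.
    by exists 0; [apply/U0 | rewrite linear0].
  - by move=> x; rewrite /U ltnn; apply/idP; apply/sub_ofE.
  move=> k; rewrite ltnS leq_eqVlt => /orP[/eqP ->|km].
    rewrite /U /Nk ltnn leqnn.
    apply: (@is_factorP _ _ _ _ _ idfun p) => //.
    - by move=> y; rewrite sub_ofE; split=> // _; exists y.
    - by move=> x; rewrite kp sub_ofE; split=> [[y e]|[y _ e]]; exists y => //; rewrite Um.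
    - by move=> x _; apply/sub_ofE.
  rewrite /U /Nk km (ltnW km); have [sub [g [sg kg]]] := fac k km.
  apply: (@is_factorP _ _ _ _ _ (j \o subval _ : {linear _ -> _}) g) => //.
  - by apply: inj_comp => //; apply: subval_inj.
  - move=> y; rewrite sub_ofE; split=> [[x /subval_im[z <-] <-]|[z <-]].
      by exists z.
    by exists (subval _ z) => //; apply/subval_im; exists z.
  - move=> x; rewrite kg sub_ofE; split=> [h1|[y h1 /ij e]]; first by exists (subval _ x).
    by rewrite -[submod_val x]e.
  - by move=> x /sub_ofE[y /sub h1 <-]; apply/sub_ofE; exists y.
have main k : (k <= m)%N -> wfilt w Theta (\sum_(i < k) w (N i))%N (submod_type (U k)).
  elim: k => [|k IH] km.
    rewrite big_ord0; apply: WfiltZero => x; apply: subval_inj.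
    by rewrite linear0; apply/U0/subval_im; exists x.
  have [sub [g [sg kg]]] := fac k km.
  have [|t ht] := @factor_inj _ _ _ _ (subval (U k.+1)) (subval (U k)) (@subval_inj _ _ _).
    by move=> x; apply/subval_im/sub/subval_im; exists x.
  rewrite big_ord_recr /=; apply: (@WfiltStep _ _ _ _ _ _ t g _ (hT k km) (IH (ltnW km))).
  split=> //.
    by move=> x y e; apply: (@subval_inj _ _ (U k)); rewrite -!ht e.
  move=> y; rewrite kg; split=> [/subval_im[x ex]|[x <-]].
    by exists x; apply: (@subval_inj _ _ (U k.+1)); rewrite ht ex.
  by apply/subval_im; exists x; rewrite -ht.
apply: wfilt_iso (main m (leqnn m)).
apply: iso_surj (@subval_inj _ _ _) _ => y; apply/subval_im; by rewrite Um.
Qed.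

End Wfilt.

Section Filtered.
Variable Theta : lmodType A -> Prop.

Let Thetai N := exists2 D, Theta D & iso_mod N D.

Lemma filtered_wfilt M : filtered Theta M <-> wfilt (fun _ => 0%N) Thetai 0 M.
Proof.
split=> [[m [U [N [h1 h2]]]]|/wfiltP[m [U [N [h1 h2 _]]]]]; last by exists m, U, N.
by apply/wfiltP; exists m, U, N; split=> //; rewrite big1.
Qed.

Lemma filtered_zero M : zero_mod M -> filtered Theta M.
Proof. by move=> hz; apply/filtered_wfilt/WfiltZero. Qed.

Lemma filtered_ext X Y Z (j : {linear X -> Y}) (p : {linear Y -> Z}) :
  ses j p -> filtered Theta X -> filtered Theta Z -> filtered Theta Y.
Proof.
by move=> h /filtered_wfilt hX /filtered_wfilt hZ; apply/filtered_wfilt/(wfilt_ext h hX hZ).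
Qed.

Lemma filtered_iso X Y : iso_mod X Y -> filtered Theta X -> filtered Theta Y.
Proof. by move=> h /filtered_wfilt hX; apply/filtered_wfilt/(wfilt_iso h hX). Qed.

Lemma zero_exists : exists Z, zero_mod Z.
Proof. by exists (free_mod A 0) => f; apply/ffunP => -[]. Qed.

Lemma filtered_one D : Theta D -> filtered Theta D.
Proof.
move=> hD; have [Z hZ] := zero_exists; apply/filtered_wfilt.
have h : ses (\0 : {linear Z -> D}) (idfun : {linear D -> D}).
  split=> [x y _|y|y]; first by rewrite (hZ x) (hZ y).
    by exists y.
  by split=> [/= ->|[x <-]] //; exists 0.
apply: (@WfiltStep (fun _ => 0%N) Thetai 0 _ _ _ _ _ h); last exact: WfiltZero.
by exists D => //; apply: iso_refl.
Qed.

Lemma filtered_ind (P : lmodType A -> Prop) :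
  (forall M, zero_mod M -> P M) ->
  (forall M' M D (j : {linear M' -> M}) (p : {linear M -> D}),
     ses j p -> Theta D -> filtered Theta M' -> P M' -> P M) ->
  forall M, filtered Theta M -> P M.
Proof.
move=> h0 hS M /filtered_wfilt hM.
suff: filtered Theta M /\ P M by case.
elim: hM => {M} [M hz|r M' M N j p h [D hD /iso_modP[f [g [fg gf]]]] _ [hM' PM']].
  by split; [apply: filtered_zero | apply: h0].
have h' := ses_iso_r (can_inj fg) (fun y => ex_intro _ (g y) (gf y)) h.
by split; [apply: filtered_ext h' hM' (filtered_one hD) | apply: hS h' hD hM' PM'].
Qed.

End Filtered.
Lemma comp_mult_wfilt M E r : comp_mult M E r <->
  wfilt (fun N => nat_of_bool `[< iso_mod N E >]) (@simple_mod A) r M.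
Proof.
rewrite wfiltP; split=> [[m [U [N [J [h1 h2 h3 <-]]]]]|[m [U [N [h1 h2 <-]]]]].
  exists m, U, N; split=> //; rewrite -sum1_card [RHS]big_mkcond.
  apply: eq_bigr => i _; case: asboolP => h; first by rewrite (iffRL (h3 i)).
  by case: ifP => // /h3.
exists m, U, N, [set k : 'I_m | `[< iso_mod (N k) E >]]; split=> //.
  by move=> k; rewrite inE; split=> /asboolP.
rewrite -sum1_card [LHS]big_mkcond; apply: eq_bigr => i _; rewrite inE.
by case: asboolP.
Qed.

(** Long exact sequences are cut at their images into short ones, so that dimension shifting becomes
    an induction on [d]. *)
Fixpoint cores (C : lmodType A -> Prop) d X : Prop :=
  if d is d'.+1 then exists M X' (i : {linear X -> M}) (q : {linear M -> X'}),
    [/\ ses i q, C M & cores C d' X'] else C X.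

Fixpoint res (C : lmodType A -> Prop) d X : Prop :=
  if d is d'.+1 then exists M X' (i : {linear X' -> M}) (q : {linear M -> X}),
    [/\ ses i q, C M & res C d' X'] else C X.

Section Resolutions.
Variable C : lmodType A -> Prop.
Hypothesis Ciso : forall M N, iso_mod M N -> C M -> C N.

Lemma coresolutionP X d : coresolution C X d <-> cores C d X.
Proof.
split.
  elim: d X => [|d IH] X [M [eps [f [ie h0 hS hC hz]]]] /=.
    apply: Ciso (hC 0%N (leqnn _)); apply: iso_sym; apply: (iso_surj ie) => y.
    by apply/h0; apply: hz.
  have [X' [j [ij hj]]] := sub_ex (sm_range (f 0%N)).
  have [|q hq] := @factor_inj _ _ _ _ j (f 0%N) ij.
    by move=> z; apply/hj; exists z.
  exists (M 0%N), X', eps, q; split; last 1 first.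
  - apply: IH; exists (fun i => M i.+1), j, (fun i => f i.+1); split=> //.
    + by move=> y; rewrite hS hj.
    + by move=> i hi; exact: (hC i.+1).
    + by move=> i hi; exact: (hz i.+1).
  - split=> //.
      move=> x; have /hj[y ey] : exists x', j x' = j x by exists x.
      by exists y; apply: ij; rewrite hq.
    move=> y; rewrite -h0 -hq; split=> [->|]; first by rewrite linear0.
    exact: inj_lin0.
  - exact: hC.
elim: d X => [|d IH] X /=.
  move=> CX; have [Z hZ] := zero_exists.
  exists (fun i => if i is 0%N then X else Z), idfun, (fun i => \0); split=> //.
  - by move=> y; split=> // _; exists y.
  - by move=> i y; split=> // _; exists 0; rewrite (hZ y).
  - by case.
  - by case.
move=> [M0 [X' [i0 [q [h CM /IH[M [eps [f [ie h0 hS hC hz]]]]]]]]].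
have [ii sq kq] := h.
pose M' i : lmodType A := if i is k.+1 then M k else M0.
exists M', i0.
exists (fun i => match i return {linear M' i -> M' i.+1} with
  | 0%N => eps \o q : {linear _ -> _} | k.+1 => f k end).
split=> //.
- move=> y /=; rewrite -kq; split=> [|->]; last by rewrite linear0.
  exact: inj_lin0.
- case=> [|i] y /=; last exact: hS.
  rewrite h0; split=> [[x <-]|[x <-]]; last by exists (q x).
  by have [z <-] := sq x; exists z.
- by case=> [|i] // hi; exact: (hC i).
- by case=> [|i] // hi; exact: (hz i).
Qed.

Lemma resolutionP X d : resolution C X d <-> res C d X.
Proof.
split.
  elim: d X => [|d IH] X [M [eps [f [se h0 hS hC hz]]]] /=.
    apply: Ciso (hC 0%N (leqnn _)); apply: iso_surj _ se; apply: lin_inj => x /h0[y <-].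
    by rewrite (hz 1%N (ltnSn _) y) linear0.
  have [X' [j [ij hj]]] := sub_ex (sm_ker eps).
  have [|q hq] := @factor_inj _ _ _ _ j (f 0%N) ij.
    by move=> z; apply/hj/h0; exists z.
  exists (M 0%N), X', j, eps; split=> //.
  - exact: hC.
  - apply: IH; exists (fun i => M i.+1), q, (fun i => f i.+1); split=> //.
    + move=> x; have /h0[y ey] : eps (j x) = 0 by apply/hj; exists x.
      by exists y; apply: ij; rewrite hq.
    + move=> y; rewrite -hS -hq; split=> [->|]; first by rewrite linear0.
      exact: inj_lin0.
    + by move=> i hi; exact: (hC i.+1).
    + by move=> i hi; exact: (hz i.+1).
elim: d X => [|d IH] X /=.
  move=> CX; have [Z hZ] := zero_exists.
  exists (fun i => if i is 0%N then X else Z), idfun, (fun i => \0); split=> //.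
  - by move=> x; exists x.
  - by move=> y; split=> [/= ->|[x <-]] //; exists 0.
  - by move=> i y; split=> _; [exists 0; rewrite (hZ y) | rewrite (hZ y)].
  - by case.
  - by case.
move=> [M0 [X' [i0 [q [h CM /IH[M [eps [f [se h0 hS hC hz]]]]]]]]].
have [ii sq kq] := h.
pose M' i : lmodType A := if i is k.+1 then M k else M0.
exists M', q.
exists (fun i => match i return {linear M' i.+1 -> M' i} with
  | 0%N => i0 \o eps : {linear _ -> _} | k.+1 => f k end).
split=> //.
- move=> y /=; rewrite kq; split=> -[x <-]; last by exists (eps x).
  by have [z <-] := se x; exists z.
- case=> [|i] y /=; last exact: hS.
  rewrite -h0; split=> [|->]; last by rewrite linear0.
  exact: inj_lin0.
- by case=> [|i] // hi; exact: (hC i).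
- by case=> [|i] // hi; exact: (hz i).
Qed.

Lemma cores_mono : (exists2 Z, zero_mod Z & C Z) ->
  forall d X, cores C d X -> cores C d.+1 X.
Proof.
move=> [Z hZ CZ]; elim=> [|d IH] X; last first.
  by move=> [M [X' [i [q [h CM /IH]]]]] hX'; exists M, X', i, q.
move=> CX; exists X, Z, idfun, \0; split=> //; split=> [x y|z|x] //.
  by exists 0; rewrite (hZ z).
by split=> // _; exists x.
Qed.

End Resolutions.
End Filtrations.

(** * Primitive idempotents *)

Section Local.
Variable A : nzRingType.

(** Fitting's lemma for right multiplication by [x] on A e: once images and kernels of its powers
    are stable, they give a decomposition of [e] into orthogonal idempotents, and primitivity makes
    one of them 0. *)
Lemma fitting (e x : A) : (forall b, chain_cond b A^o) -> primitive_idem e ->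
  e * x = x -> x * e = x ->
  (exists N, x ^+ N.+1 = 0) \/ exists a, e = a * x.
Proof.
move=> fA [e0 ee prim] ex xe.
have comme k : e * x ^+ k = x ^+ k * e by apply: commrX; rewrite /GRing.comm ex xe.
have smI k : @submodule A A^o (fun t => exists a, t = a * x ^+ k).
  split=> [|a _ _ [b ->] [c ->]]; first by exists 0; rewrite mul0r.
  by exists (a * b + c); rewrite mulrDl -mulrA.
have smA k : @submodule A A^o (fun a => a * x ^+ k = 0).
  split=> [|a b c]; rewrite ?mul0r // => h1 h2.
  by rewrite mulrDl -[a *: b]/(a * b) -mulrA h1 h2 mulr0 addr0.
have [|U [hU [k0 hk0] mU]] := fA false (fun U => exists k, forall t, U t <-> exists a, t = a * x ^+ k).
  by exists (fun t => exists a, t = a * x ^+ 0) => //; exists 0%N.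
have st0 k : exists a, x ^+ k0 = a * x ^+ (k0 + k).
  apply/(mU _ (smI _)); last by apply/hk0; exists 1; rewrite mul1r.
    by exists (k0 + k)%N.
  by move=> t /= [a ->]; apply/hk0; exists (a * x ^+ k); rewrite -mulrA -exprD addnC.
have [|V [hV [k1 hk1] mV]] := fA true (fun U => exists k, forall a, U a <-> a * x ^+ k = 0).
  by exists (fun a => a * x ^+ 0 = 0) => //; exists 0%N.
have st1 k a : a * x ^+ (k1 + k) = 0 -> a * x ^+ k1 = 0.
  move=> ha; apply/hk1/(mV _ (smA (k1 + k)%N)) => //; first by exists (k1 + k)%N.
  by move=> t /= /hk1 h; rewrite exprD mulrA h mul0r.
(* The exponent [N.+1] is positive and beyond both thresholds: [k0] for the images A x^k and [k1]
   for the annihilators. *)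
pose N := (k0 + k1)%N; pose y := x ^+ N.+1.
have [b hb] : exists b, y = b * (y * y).
  have [b hb] := st0 N.+1; exists b.
  have -> : y * y = x ^+ (k0 + N.+1) * x ^+ k1.+1.
    by rewrite /y -!exprD [in RHS]addnAC [(k0 + k1.+1)%N]addnS.
  by rewrite mulrA -hb -exprD addnS.
have kery a : a * y * y = 0 -> a * y = 0.
  rewrite -mulrA -exprD => h.
  have -> : a * y = a * x ^+ k1 * x ^+ k0.+1.
    by rewrite -mulrA -exprD addnS addnC.
  rewrite (st1 (k0.+1 + N.+1)%N) ?mul0r //.
  by rewrite -h /N; congr (_ * x ^+ _); rewrite addnA; congr (_ + _)%N; rewrite addnS addnC.
have ey : e * y = y by rewrite /y exprS mulrA ex.
have ye : y * e = y by rewrite /y exprSr -mulrA xe.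
(* Right multiplication by [f] projects A e onto A y: f y = y, while the complement [g] satisfies g
   y = 0. If f = 0 then y = 0; if g = 0 then [e] lies in A y. *)
pose f := e * b * y; pose g := e - f.
have ef : e * f = f by rewrite /f !mulrA ee.
have fe : f * e = f by rewrite /f -mulrA ye.
have gy : g * y = 0 by rewrite mulrBl ey /f -!mulrA -hb ey subrr.
have ff : f * f = f.
  apply/esym/eqP; rewrite -subr_eq0 -{1}fe -mulrBr -/g; apply/eqP.
  have -> : f * g = (e * b - f * (e * b)) * y.
    by rewrite /g mulrBr fe mulrBl -[f * _ * y]mulrA -/f.
  apply: kery; have -> : (e * b - f * (e * b)) * y = f * g.
    by rewrite /g mulrBr fe mulrBl -[f * _ * y]mulrA -/f.
  by rewrite -mulrA gy mulr0.
have fg : f * g = 0 by rewrite /g mulrBr fe ff subrr.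
have gf : g * f = 0 by rewrite /g mulrBl ef ff subrr.
have gg : g * g = g by rewrite {1}/g mulrBl fg subr0 /g mulrBr ee ef.
have [f0|g0] := prim f g ff gg fg gf (esym (subrKC _ _)).
- left; exists N; rewrite -/y -ey.
  by have := gy; rewrite /g f0 subr0.
- right; exists (e * b * x ^+ N); rewrite -mulrA -exprSr -/y -/f.
  by apply/eqP; rewrite -subr_eq0 -/g g0.
Qed.

(** The module A e is local. With x = e u, Fitting's lemma either puts [e] into A x, hence into [U],
    or makes [x] nilpotent, and then e = x + e v is recovered from [v] alone. *)
Lemma local_idem (e u v : A) (U V : A^o -> Prop) :
  (forall b, chain_cond b A^o) -> primitive_idem e -> submodule U -> submodule V ->
  u * e = u -> v * e = v -> U u -> V v -> u + v = e -> U e \/ V e.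
Proof.
move=> fA he hU hV ue ve Uu Vv uv; have [e0 ee _] := he.
pose x := e * u.
have ex : e * x = x by rewrite /x mulrA ee.
have xe : x * e = x by rewrite /x -mulrA ue.
case: (fitting fA he ex xe) => [[N xN]|[a ea]]; last first.
  by left; rewrite ea /x mulrA; apply: (smZ (a * e) hU Uu).
right; have comme k : e * x ^+ k = x ^+ k * e by apply: commrX; rewrite /GRing.comm ex xe.
have evx : x + e * v = e by rewrite -mulrDr uv ee.
(* Descent on the exponent j of [x], from e x^j = e x^(j+1) + (e x^j e) v; nilpotency starts it and
   j = 0 is the claim. *)
suff h k : (k <= N.+1)%N -> V (e * x ^+ (N.+1 - k)).
  by have := h N.+1 (leqnn _); rewrite subnn expr0 mulr1.
elim: k => [|k IH] kN; first by rewrite subn0 xN mulr0; case: hV.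
have {}IH := IH (ltnW kN).
have -> : e * x ^+ (N.+1 - k.+1) = e * x ^+ (N.+1 - k) + (e * x ^+ (N.+1 - k.+1) * e) * v.
  have -> : (N.+1 - k = (N.+1 - k.+1).+1)%N by rewrite subnSK.
  rewrite exprSr mulrA -[_ * e * v]mulrA -mulrDr evx -mulrA -comme mulrA ee.
  by [].
exact: (smD hV IH (smZ (e * x ^+ (N.+1 - k.+1) * e) hV Vv)).
Qed.

End Local.

(** * Induction along simple submodules *)

Section FiniteLength.
Variable A : nzRingType.
Hypothesis finA : forall b (M : lmodType A), fin_gen M -> chain_cond b M.
Implicit Types D K M N P Q S W X Y Z : lmodType A.

Lemma fin_gen_sub M N (j : {linear N -> M}) : injective j -> fin_gen M -> fin_gen N.
Proof. by move=> ij fM; apply: noeth_fin_gen; apply: fin_inj ij (finA _ fM). Qed.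

Lemma fin_gen_regular : fin_gen A^o.
Proof.
by exists 1%N, (fun _ => 1) => y; exists (fun _ => y); rewrite big_ord1 /*:%R /= mulr1.
Qed.

Lemma finlen_ind (C : lmodType A -> Prop) :
  (forall M, zero_mod M -> C M) ->
  (forall S X X'' (j : {linear S -> X}) (p : {linear X -> X''}), ses j p ->
     simple_mod S -> fin_gen X -> fin_gen X'' -> C X'' -> C X) ->
  forall M, fin_gen M -> C M.
Proof.
move=> h0 hS M fM; suff: fin_gen M -> C M by apply.
apply: (@noeth_ind A (fun M => fin_gen M -> C M)) (finA _ fM) => Q _ IH fQ.
case: (pselect (zero_mod Q)) => nz; first exact: h0.
have [S [j [simS ij]]] := simple_sub (finA _ fQ) nz.
have [X'' [p h]] := ses_coker ij; have [_ sp _] := h.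
have fX : fin_gen X'' by apply: fin_gen_surj fQ.
apply: (hS _ _ _ _ _ h) => //; apply: (IH _ p sp) => //.
apply: contrapT => nx; apply: simS.1 => s; apply: contrapT => ns; apply: nx.
exists (j s); last exact: ses_pj h.
by move=> /(inj_lin0 ij).
Qed.

Lemma simple_ker S M (f : {linear S -> M}) : simple_mod S ->
  (forall x, f x = 0) \/ injective f.
Proof.
move=> [_ hS]; case: (hS (sub_of (sm_ker f))) => h; [right|left] => x.
  by move=> y; apply: (lin_inj (j := f)) => z fz; apply: h; apply/sub_ofE.
by have /sub_ofE : x \in sub_of (sm_ker f) by rewrite h.
Qed.

Lemma simple_range S M (f : {linear M -> S}) : simple_mod S ->
  (forall x, f x = 0) \/ surj f.
Proof.
move=> [_ hS]; case: (hS (sub_of (sm_range f))) => h; [left|right] => x.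
  by apply: h; apply/sub_ofE; exists x.
by have /sub_ofE : x \in sub_of (sm_range f) by rewrite h.
Qed.

End FiniteLength.

(** * Indecomposable projectives, their tops and composition multiplicities *)

Section Idempotents.
Variable A : nzRingType.
Hypothesis finA : forall b (M : lmodType A), fin_gen M -> chain_cond b M.
Variables (n : nat) (e : 'I_n -> A).
Hypothesis he : complete_primitive_orthogonal e.
Variable E : 'I_n -> lmodType A.
Hypothesis hE : forall i, is_top (principal (e i)) (E i).
Implicit Types C D K M N Q S W X Y Z : lmodType A.

Local Notation P i := (principal (e i)).

Lemma idem_prim i : primitive_idem (e i). Proof. by case: he. Qed.
Lemma idemM i : e i * e i = e i. Proof. by have [] := idem_prim i. Qed.

Fact gen_in i : e i \in left_ideal (e i).
Proof. by apply/asboolP; exists 1; rewrite mul1r. Qed.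
Definition gen i : P i := SubMod (gen_in i).

Definition pval i : {linear P i -> A^o} := subval _.

Lemma pval_e i (y : P i) : (pval i y : A) * e i = pval i y.
Proof.
have /asboolP[a ea] := submod_valP y.
by rewrite [pval i y]ea -mulrA idemM.
Qed.

Lemma pgen i (y : P i) : y = (pval i y : A) *: gen i.
Proof. by apply: (@subval_inj _ _ _); rewrite linearZ; symmetry; exact: pval_e. Qed.

Lemma e_gen i : e i *: gen i = gen i.
Proof. by apply: (@subval_inj _ _ _); rewrite linearZ; exact: idemM. Qed.

Lemma P_map i X (x : X) : exists f : {linear P i -> X}, f (gen i) = e i *: x.
Proof.
have h : linear (fun y : P i => (pval i y : A) *: x).
  by move=> a y z; rewrite linearP scalerDl scalerA.
by exists (mklin h).
Qed.

Lemma P_ext i X (f g : {linear P i -> X}) : f (gen i) = g (gen i) -> forall y, f y = g y.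
Proof. by move=> h y; rewrite (pgen y) !linearZ_LR h. Qed.

Lemma P_proj i : projective_mod (P i).
Proof.
move=> X Y p f sp; have [x px] := sp (f (gen i)).
have [h hh] := P_map i x; exists h.
by apply: (@P_ext _ _ (p \o h)); rewrite /= hh linearZ_LR px -linearZ_LR e_gen.
Qed.

Lemma P_retract i : exists r : {linear A^o -> P i}, cancel (pval i) r.
Proof.
have h : linear (fun a : A^o => (a : A) *: gen i).
  by move=> a y z; rewrite scalerDl -scalerA.
by exists (mklin h) => y; rewrite [RHS]pgen.
Qed.

Lemma P_fin_gen i : fin_gen (P i).
Proof.
have [r pr] := P_retract i; apply: (@fin_gen_surj _ _ _ r) (fin_gen_regular A).
by move=> y; exists (pval i y).
Qed.

(** For finitely generated [M] this expresses that E(i) is not a composition factor; unlike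
    multiplicities, it passes visibly to submodules, factors and extensions. *)
Definition kills i M := forall x : M, e i *: x = 0.

Lemma e_nonzero M (x : M) : x <> 0 -> exists i, e i *: x <> 0.
Proof.
move=> nx; apply: contrapT => h; apply: nx.
have [_ _ e1] := he; rewrite -[x]scale1r -e1 scaler_suml big1 // => i _.
by apply: contrapT => hi; apply: h; exists i.
Qed.

Lemma kills_ses i X Y Z (j : {linear X -> Y}) (p : {linear Y -> Z}) :
  ses j p -> kills i X -> kills i Z -> kills i Y.
Proof.
move=> [ij sp kp] hX hZ y.
have /kp[x ex] : p (e i *: y) = 0 by rewrite linearZ_LR hZ.
by rewrite -idemM -scalerA -ex -linearZ_LR hX linear0.
Qed.

Lemma kills_inj i M N (j : {linear N -> M}) : injective j -> kills i M -> kills i N.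
Proof. by move=> ij hM x; apply: (inj_lin0 ij); rewrite linearZ_LR hM. Qed.

Lemma kills_surj i M N (p : {linear M -> N}) : surj p -> kills i M -> kills i N.
Proof. by move=> sp hM x; have [y <-] := sp x; rewrite -linearZ_LR hM linear0. Qed.

(** By locality of A e_i, the sum of two submodules avoiding the generator avoids it too. So there
    is a largest such submodule; it is the unique maximal one, hence the kernel of the map to the
    top. *)
Lemma top_map i : exists p : {linear P i -> E i},
  [/\ surj p, p (gen i) <> 0 &
      forall V : P i -> Prop, submodule V -> ~ V (gen i) -> forall x, V x -> p x = 0].
Proof.
have allV (V : P i -> Prop) : submodule V -> V (gen i) -> forall x, V x.
  by move=> hV Vg x; rewrite (pgen x); apply: smZ.
have gen0 : gen i <> 0.
  move=> g0; have [+ _ _] := idem_prim i.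
  by move/eqP; apply; exact: (congr1 (pval i) g0).
have [|U [hU nU mU]] := finA true (P_fin_gen i) (S := fun U => ~ U (gen i)).
  by exists (fun x => x = 0); first exact: sm_zero.
have largest (V : P i -> Prop) : submodule V -> ~ V (gen i) -> forall x, V x -> U x.
  move=> hV nV x Vx.
  apply/(mU _ (sm_add hU hV)) => /=.
  - move=> [u Uu Vu].
    have tr (V' : P i -> Prop) : submodule V' -> @submodule A A^o (fun a => exists2 y, V' y & pval i y = a).
      by move=> hV'; apply: sm_im.
    have fA b : chain_cond b A^o by apply/finA/fin_gen_regular.
    have [||||||] := local_idem fA (idem_prim i) (tr _ hU) (tr _ hV)
      (u := pval i u) (v := pval i (gen i - u)).
    + exact: pval_e.
    + exact: pval_e.
    + by exists u.
    + by exists (gen i - u).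
    + by rewrite linearB addrC subrK.
    + by move=> [y Uy ey]; apply: nU; rewrite -(@subval_inj _ _ _ y (gen i)).
    + by move=> [y Vy ey]; apply: nV; rewrite -(@subval_inj _ _ _ y (gen i)).
  - by move=> y Uy; exists y => //; rewrite subrr; case: hV.
  - by exists 0; [case: hU | rewrite subr0].
have [p [sp kp]] := hE i.
have Up x : p x = 0 <-> U x.
  rewrite kp; split=> [h|Ux W [[z nW] mW]].
    have /sub_ofE : x \in sub_of hU; last by [].
    apply: h; split; first by exists (gen i); apply/negP => /sub_ofE.
    move=> V UV; case: (pselect ((gen i) \in V)) => gV; [right|left] => y.
      by rewrite inE; apply: (allV _ (sm_mem V) gV).
    apply/idP/idP => [yV|]; last exact: UV.
    by apply/sub_ofE; apply: (largest _ (sm_mem V) gV).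
  have nWg : ~ (gen i \in W).
    by move=> Wg; move/negP: nW; apply; apply: (allV _ (sm_mem W) Wg).
  have WU : {subset W <= sub_of hU}.
    by move=> y Wy; apply/sub_ofE; apply: (largest _ (sm_mem W) nWg).
  case: (mW _ WU) => eq; first by rewrite -eq; apply/sub_ofE.
  by have /sub_ofE : gen i \in sub_of hU by rewrite eq.
exists p; split=> //; first by move=> /Up.
by move=> V hV nV x Vx; apply/Up; apply: (largest _ hV nV).
Qed.

Lemma simple_E i : simple_mod (E i).
Proof.
have [p [sp pg big]] := top_map i; split; first by move=> hz; apply: pg.
move=> V; case: (pselect (p (gen i) \in V)) => gV; [right|left] => x.
  have [y <-] := sp x; rewrite (pgen y) linearZ_LR inE.
  by apply: rpredZ.
have [y <-] := sp x => Vy.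
exact: (big (fun y => p y \in V) (sm_preim p (sm_mem V)) gV).
Qed.

Lemma E_gen i : exists t : E i, t <> 0 /\ e i *: t = t.
Proof.
have [p [sp pg _]] := top_map i; exists (p (gen i)).
by rewrite -linearZ_LR e_gen.
Qed.

Lemma E_not_killed i : ~ kills i (E i).
Proof. by have [t [nt et]] := E_gen i; move=> /(_ t); rewrite et. Qed.

Lemma simple_iso i S (s : S) : simple_mod S -> e i *: s <> 0 -> iso_mod S (E i).
Proof.
move=> hS ns; have [f hf] := P_map i s.
have [p [sp pg big]] := top_map i.
have sf : surj f.
  case: (simple_range f hS) => // h0; case: ns; rewrite -hf; exact: h0.
have [|g hg] := factor_surj (f := p) sf.
  by move=> x fx; apply: (big _ (sm_ker f)) => //; rewrite hf.
apply: (iso_surj (f := g)).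
  case: (simple_ker g hS) => // h0; case: pg; rewrite -hg; exact: h0.
by move=> y; have [x <-] := sp y; exists (f x).
Qed.

Lemma simple_E_sub S : simple_mod S -> exists i, iso_mod S (E i).
Proof.
move=> hS; have [s ns] : exists s : S, s <> 0.
  by apply: contrapT => h; apply: hS.1 => s; apply: contrapT => ns; apply: h; exists s.
by have [i hi] := e_nonzero ns; exists i; apply: simple_iso hi.
Qed.

Lemma iso_kills i M N : iso_mod M N -> kills i M -> kills i N.
Proof. by move=> /iso_modP[f [g [_ gf]]]; apply: (kills_surj (p := f)) => y; exists (g y). Qed.

Lemma comp_mult_kills i M : comp_mult M (E i) 0 -> kills i M.
Proof.
move=> /comp_mult_wfilt; move: {-2}0%N (erefl 0%N) => r + hM.
elim: hM => {r M} [M hz _ x|r M' M N j p h simN hM' IH /eqP]; first by rewrite (hz x) scaler0.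
rewrite addn_eq0 => /andP[/eqP r0]; case: asboolP => // nN _.
apply: (kills_ses h (IH r0)) => s; apply: contrapT => ns; apply: nN.
exact: simple_iso ns.
Qed.

Lemma wfilt_one w (Theta : lmodType A -> Prop) N : Theta N -> wfilt w Theta (w N) N.
Proof.
move=> hN; have [Z hZ] := zero_exists A.
have h : ses (\0 : {linear Z -> N}) (idfun : {linear N -> N}).
  split=> [x y _|y|y]; first by rewrite (hZ x) (hZ y).
    by exists y.
  by split=> [/= ->|[x <-]] //; exists 0.
by rewrite -[w N]add0n; apply: WfiltStep h hN _; apply: WfiltZero.
Qed.

Lemma wfilt_killed i M : fin_gen M -> kills i M ->
  wfilt (fun N => nat_of_bool `[< iso_mod N (E i) >]) (@simple_mod A) 0 M.
Proof.
move: M; apply: (finlen_ind finA) => [M hz _|S X X'' j p h simS _ _ IH hX].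
  exact: WfiltZero.
have [ij sp _] := h.
have := wfilt_ext h (wfilt_one _ simS) (IH (kills_surj sp hX)).
case: asboolP => // hS; case: (@E_not_killed i).
exact: iso_kills hS (kills_inj ij hX).
Qed.

Lemma killed_comp_mult i M : fin_gen M -> kills i M -> comp_mult M (E i) 0.
Proof. by move=> fM hM; apply/comp_mult_wfilt/wfilt_killed. Qed.

Lemma comp_mult_pos_nonzero i M r : comp_mult M (E i) r.+1 -> ~ zero_mod M.
Proof.
move=> /comp_mult_wfilt; move: {-2}(r.+1) (erefl r.+1) => k ek hM.
case: hM ek => // {k M} k M' M N j p [ij sp _] [nN _] _ _ hz; apply: nN => y.
by have [x <-] := sp y; rewrite (hz x) linear0.
Qed.

(* Stands in for the Jordan-Hoelder theorem. *)
Lemma comp_mult1_socle i M (iota : {linear E i -> M}) :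
  comp_mult M (E i) 1 -> injective iota ->
  forall x, exists y, iota y = e i *: x.
Proof.
move=> /comp_mult_wfilt; move: {-2}1%N (erefl 1%N) => r + hM.
elim: hM iota => {r M} // r M' M N j p h simN hM' IH iota /eqP er ii x.
have [ij sp kp] := h; have [t [nt et]] := E_gen i.
(* If the top factor is E(i), the rest is killed by e_i and [iota] maps E(i) isomorphically onto
   [N]. Otherwise e_i kills [N], and both [iota] and [e i *: x] live in M'. *)
case: asboolP er => hN er.
  have r0 : r = 0%N by apply/eqP; rewrite -(eqn_add2r 1).
  have kM' : kills i M' by apply: comp_mult_kills; apply/comp_mult_wfilt; rewrite -r0.
  have ipi : injective (p \o iota).
    case: (simple_ker (p \o iota : {linear _ -> _}) (simple_E i)) => // h0.
    have /kp[y ey] := h0 t; case: nt; apply: (inj_lin0 ii).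
    by rewrite -et linearZ_LR -ey -linearZ_LR kM' linear0.
  have spi : surj (p \o iota).
    case: (simple_range (p \o iota : {linear _ -> _}) simN) => // h0; case: nt.
    by apply: ipi; rewrite h0 linear0.
  have [s es] := spi (p x); exists (e i *: s).
  have /kp[y ey] : p (x - iota s) = 0 by rewrite linearB [p (iota s)]es subrr.
  apply/eqP; rewrite eq_sym -subr_eq0 linearZ_LR -scalerBr -ey -linearZ_LR kM'.
  by rewrite linear0.
have kN : kills i N by move=> s; apply: contrapT => ns; apply: hN; apply: simple_iso ns.
have r1 : r = 1%N by move: er; rewrite addn0 => /eqP.
have [|iota' hi'] := @factor_inj _ _ _ _ j iota ij.
  case: (simple_ker (p \o iota : {linear _ -> _}) (simple_E i)) => h0.
    by move=> s; apply/kp; apply: h0.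
  by case: nt; apply: h0; rewrite /= -et !linearZ_LR kN !linear0.
have /kp[y ey] : p (e i *: x) = 0 by rewrite linearZ_LR kN.
have [|z ez] := IH iota' r1 _ y.
  by move=> s s' es; apply: ii; rewrite -!hi' es.
exists z; rewrite -hi' ez linearZ_LR ey scalerA idemM //.
Qed.

Lemma no_factorP i M : fin_gen M ->
  no_factor_above E i M <-> forall l : 'I_n, (i < l)%N -> kills l M.
Proof.
move=> fM; split=> h l il; first exact/comp_mult_kills/h.
by apply: killed_comp_mult => //; apply: h.
Qed.

(** * Standard and proper costandard modules *)

Variables (I Delta nabla pnabla : 'I_n -> lmodType A).
Hypothesis hI : forall i, is_injective_envelope (E i) (I i).
Hypothesis hDelta : is_standard (fun i => P i) E Delta.
Hypothesis hnabla : is_costandard I E nabla.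
Hypothesis hpnabla : is_proper_costandard nabla E pnabla.

Lemma kills_idem i X Y Z (j : {linear X -> Y}) (p : {linear Y -> Z}) y :
  ses j p -> kills i Z -> exists x, j x = e i *: y.
Proof. by move=> [_ _ kp] hZ; apply/kp; rewrite linearZ_LR hZ. Qed.

(** Everything needed about the proper costandard module, freed from multiplicities: E(i) is its
    essential socle, the part e_l for l >= i lies in that socle, and it is maximal in I(i) among
    overmodules that gain no factor E(l) with l >= i. *)
Lemma pnabla_socle i : exists (v : {linear pnabla i -> I i}) (iota : {linear E i -> pnabla i}),
  [/\ injective v, injective iota,
      forall l : 'I_n, (i < l)%N -> kills l (pnabla i),
      forall l : 'I_n, (i <= l)%N -> forall x, exists y, iota y = e l *: x &
      [/\ forall U : pnabla i -> Prop, submodule U -> (forall x, U (iota x) -> x = 0) ->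
        forall x, U x -> x = 0 &
      forall V : I i -> Prop, submodule V -> (forall x, V (v x)) ->
        (forall l : 'I_n, (i <= l)%N -> forall y, V y -> exists x, v x = e l *: y) ->
        forall y, V y -> exists x, v x = y]].
Proof.
have [fI injI [j [ij ess]]] := hI i.
have [nf [j1 [ij1 max1]]] := hnabla i.
have [cm [j2 [ij2 max2]]] := hpnabla i.
have knab (l : 'I_n) : (i < l)%N -> kills l (nabla i) by move=> /nf; apply: comp_mult_kills.
have kpn (l : 'I_n) : (i < l)%N -> kills l (pnabla i) by move=> /knab; apply: (kills_inj ij2).
pose v : {linear pnabla i -> I i} := j1 \o j2.
have iv : injective v by apply: inj_comp.
have hU := sm_preim j (sm_range v).
(* The multiplicity 1 makes [pnabla i] nonzero, so it meets the essential submodule E(i) of I(i); by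
   simplicity it contains it. *)
have [x0 nx0 Ux0] : exists2 x, x <> 0 & exists z, v z = j x.
  apply: contrapT => h; apply: (comp_mult_pos_nonzero cm) => z; apply: (inj_lin0 iv).
  apply: (ess (sub_of (sm_range v))); last by apply/sub_ofE; exists z.
  move=> x /sub_ofE[z' hz']; apply: contrapT => nx; apply: h.
  by exists x => //; exists z'.
have allU x : exists z, v z = j x.
  case: (simple_E i) => _ /(_ (sub_of hU)) [h|h].
    by case: nx0; apply: h; apply/sub_ofE.
  by have /sub_ofE : x \in sub_of hU by rewrite h.
have [iota hiota] := factor_inj iv allU.
have ii : injective iota by move=> x y e'; apply: ij; rewrite -!hiota e'.
exists v, iota; split=> //.
  move=> l; rewrite leq_eqVlt => /orP[/eqP/val_inj <- x|/kpn kl x].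
    exact: comp_mult1_socle.
  by exists 0; rewrite linear0 kl.
split=> [U smU hUi x Ux|V hV Vv Ve y Vy].
  apply: (inj_lin0 iv); apply: (ess (sub_of (sm_im v smU))) => [z|].
    by move=> /sub_ofE[x' Ux' ex]; apply: hUi; rewrite -(iv _ _ (etrans ex (esym (hiota z)))).
  by apply/sub_ofE; exists x.
have [N [k [ik hk]]] := sub_ex hV.
have fN : fin_gen N by apply: fin_gen_sub ik fI.
(* For l > i, e_l V = e_l (e_l V) lies in e_l applied to [pnabla i], which is 0; hence V is
   contained in the costandard module. *)
have kin : forall z, exists x, k z = j1 x.
  apply: max1 => //; apply/no_factorP => // l il z; apply: (inj_lin0 ik).
  have [|x ex] := Ve l (ltnW il) (k z); first by apply/hk; exists z.
  by rewrite linearZ_LR -(idemM l) -scalerA -ex -linearZ_LR kpn // linear0.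
have [|k' hk'] := @factor_inj _ _ _ _ j1 k ij1.
  by move=> z; have [x ->] := kin z; exists x.
have ik' : injective k' by move=> z z' ez; apply: ik; rewrite -!hk' ez.
have [|j3 hj3] := @factor_inj _ _ _ _ k v ik; first by move=> x; apply/hk.
have ij3 : injective j3 by move=> x x' ex; apply: iv; rewrite -!hj3 ex.
have [Q [q h]] := ses_coker ij3; have [_ sq kq] := h.
(* The factor of V by [pnabla i] is killed by e_i, so the multiplicity of E(i) stays 1. *)
have cmN : comp_mult N (E i) 1.
  apply/comp_mult_wfilt; rewrite -[1%N]addn0; apply: (wfilt_ext h).
    exact/comp_mult_wfilt.
  apply: wfilt_killed; first exact: fin_gen_surj sq fN.
  move=> z; have [w <-] := sq z; rewrite -linearZ_LR; apply/kq.
  have [|x ex] := Ve i (leqnn i) (k w); first by apply/hk; exists w.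
  by exists x; apply: ik; rewrite hj3 ex linearZ_LR.
have /hk[z <-] := Vy; have [x ex] := max2 _ k' cmN ik' z.
by exists x; rewrite /v /= -ex hk'.
Qed.

Lemma fin_gen_pnabla i : fin_gen (pnabla i).
Proof.
have [v [_ [iv _ _ _ _]]] := pnabla_socle i; have [fI _ _] := hI i.
exact: fin_gen_sub iv fI.
Qed.

(** Injectivity of I(i) extends [f] to a map M -> I(i). The sum of its image and [pnabla i] gains
    only factors of [X], so by maximality the image already lies in [pnabla i]. *)
Lemma orth_pnabla_small (i : 'I_n) X : (forall l : 'I_n, (i <= l)%N -> kills l X) ->
  orth X (pnabla i).
Proof.
move=> hX K M j p h f.
have [v [_ [iv _ _ _ [_ maxv]]]] := pnabla_socle i; have [_ injI _] := hI i.
have [ij sp kp] := h.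
have [g hg] := injI _ _ j (v \o f : {linear _ -> _}) ij.
have hV := sm_add (sm_range v) (sm_range g).
have [|g' hg'] := @factor_inj _ _ _ _ v g iv.
  move=> m; apply: (maxv _ hV) => [x|l il y [_ [x <-] [m' em']]|].
  - by exists (v x); [exists x | exists 0; rewrite linear0 subrr].
  - have [k ek] := kills_idem m' h (hX l il).
    exists (e l *: x + f k); rewrite linearD linearZ_LR -[v (f k)]hg ek linearZ_LR em'.
    by rewrite -scalerDr addrC subrK.
  - by exists 0; [exists 0; rewrite linear0 | exists m; rewrite subr0].
by exists g' => x; apply: iv; rewrite hg' hg.
Qed.

(** * Presentations of the standard modules and traces *)

Lemma Delta_ses i : exists K (j : {linear K -> P i}) (d : {linear P i -> Delta i}),
  [/\ ses j d, forall l : 'I_n, (i < l)%N -> kills l (Delta i) &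
      forall N (p : {linear P i -> N}), surj p -> (forall l : 'I_n, (i < l)%N -> kills l N) ->
        forall x, d x = 0 -> p x = 0].
Proof.
have [nf [d [sd maxd]]] := hDelta i; have [K [j h]] := ses_ker sd.
exists K, j, d; split=> // [l /nf|N p sp hN]; first exact: comp_mult_kills.
apply: maxd => //; apply/no_factorP => //.
exact: fin_gen_surj sp (P_fin_gen i).
Qed.

Lemma Delta_kills (i : 'I_n) (l : 'I_n) : (i < l)%N -> kills l (Delta i).
Proof. by have [K [j [d [_ h _]]]] := Delta_ses i; apply: h. Qed.

Lemma fin_gen_Delta i : fin_gen (Delta i).
Proof. by have [K [j [d [[_ sd _] _ _]]]] := Delta_ses i; apply: fin_gen_surj sd (P_fin_gen i). Qed.

(** The submodule generated by all e_l M with l > i, that is, the trace of the P(l) with l > i in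
    [M], given as an intersection of submodules. *)
Definition trace (i : 'I_n) M (x : M) : Prop :=
  forall V : M -> Prop, submodule V -> (forall (l : 'I_n) y, (i < l)%N -> V (e l *: y)) -> V x.
Arguments trace : clear implicits.

Lemma trace_sm (i : 'I_n) M : submodule (trace i M).
Proof.
split=> [V [V0 _] _ //|a x y hx hy V hV he']; have [_] := hV; apply.
  exact: hx.
exact: hy.
Qed.

Lemma trace_e (i : 'I_n) M (l : 'I_n) (y : M) : (i < l)%N -> trace i M (e l *: y).
Proof. by move=> il V _; apply. Qed.

Lemma trace_map (i : 'I_n) M N (f : {linear M -> N}) x : trace i M x -> trace i N (f x).
Proof.
move=> hx V hV he'; apply: (hx _ (sm_preim f hV)) => l y il.
by rewrite linearZ_LR; apply: he'.
Qed.

Lemma trace_kernel (i : 'I_n) M N (f : {linear M -> N}) x :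
  (forall l : 'I_n, (i < l)%N -> kills l N) -> trace i M x -> f x = 0.
Proof.
by move=> hN /(_ _ (sm_ker f)); apply=> l y il; rewrite linearZ_LR hN.
Qed.

Lemma Delta_kernel_trace i (d : {linear P i -> Delta i}) :
  (forall N (p : {linear P i -> N}), surj p -> (forall l : 'I_n, (i < l)%N -> kills l N) ->
        forall x, d x = 0 -> p x = 0) ->
  forall x, d x = 0 <-> trace i (P i) x.
Proof.
move=> hd x; split=> [dx|]; last by apply: trace_kernel; apply: Delta_kills.
have [Q [q [sq kq]]] := quo_ex (trace_sm i (P i)).
apply/kq; apply: hd dx => // l il z; have [y <-] := sq z.
by rewrite -linearZ_LR; apply/kq; apply: trace_e.
Qed.

(** The last clause holds because the kernel [K] is generated by its own parts e_l K with l > i: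
    since Delta(i) is killed, each e_l y already lies in [K] and equals e_l (e_l y). *)
Lemma Delta_pres i : exists K (j : {linear K -> P i}) (d : {linear P i -> Delta i}),
  [/\ ses j d, forall x, d x = 0 <-> trace i (P i) x &
      forall Y (f : {linear K -> Y}), (forall l : 'I_n, (i < l)%N -> kills l Y) ->
        forall x, f x = 0].
Proof.
have [K [j [d [h hk hd]]]] := Delta_ses i; exists K, j, d; have kerd := Delta_kernel_trace hd.
split=> // Y f hY x; have [ij sd kd] := h.
have hU : submodule (fun y => exists2 x, f x = 0 & j x = y) := sm_im j (sm_ker f).
have : trace i (P i) (j x) by apply/kerd/(ses_pj _ h).
move=> /(_ _ hU) [|x' fx' /ij <- //] l y il.
have [k ek] := kills_idem y h (hk l il).
exists (e l *: k); first by rewrite linearZ_LR hY.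
by rewrite linearZ_LR ek scalerA idemM.
Qed.

Lemma orth_Delta_killed (j : 'I_n) Z : (forall l : 'I_n, (j < l)%N -> kills l Z) -> orth (Delta j) Z.
Proof.
move=> hZ; have [K [k [d [h _ h0]]]] := Delta_pres j.
apply: (orth_pres h (@P_proj j)) => f; exists \0 => x.
by rewrite (h0 _ f hZ).
Qed.

(** For j < i the factors of Delta(j) lie below i and maximality of [pnabla i] applies; for j >= i
    the presentation kernel of Delta(j) has no nonzero map to [pnabla i]. *)
Lemma orth_Delta_pnabla j (i : 'I_n) : orth (Delta j) (pnabla i).
Proof.
have [v [iota [_ _ hk _ _]]] := pnabla_socle i.
case: (ltnP j i) => ji; last first.
  by apply: orth_Delta_killed => l jl; apply: hk; apply: leq_ltn_trans jl.
by apply: orth_pnabla_small => l il; apply: Delta_kills; apply: leq_trans ji il.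
Qed.

Lemma Delta_gen i (d : {linear P i -> Delta i}) : surj d ->
  forall z, exists a, z = a *: d (gen i).
Proof.
move=> sd z; have [y <-] := sd z; exists (pval i y).
by rewrite -linearZ_LR -pgen.
Qed.

(* In a Delta-filtration the factors [Delta l] with [l > i] can be moved to the
   bottom, where they filter the trace. *)
Lemma orth_trace (i : 'I_n) Y : (forall l : 'I_n, (i < l)%N -> orth (Delta l) Y) ->
  forall M, filtered_by Delta M -> forall N (t : {linear N -> M}), injective t ->
  (forall x, trace i M x <-> exists y, t y = x) -> orth N Y.
Proof.
move=> hY; apply: filtered_ind => [M hz N t it _|M' M D j p h [l eD] _ IH N t it ht].
  by apply: orth_zero => x; apply: it; rewrite (hz (t x)) (hz (t 0)).
subst D.
have [ij sp kp] := h.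
have [N' [t' [it' ht']]] := sub_ex (trace_sm i M').
have {}IH := IH _ _ it' ht'.
have [r hr] : exists r : {linear N' -> N}, forall x, t (r x) = (j \o t') x.
  apply: factor_inj => // x; apply/ht; apply: (trace_map j); apply/ht'; by exists x.
have ir : injective r by move=> x y exy; apply: it'; apply: ij; rewrite -![j _]hr exy.
(* For l <= i the top factor contributes nothing and the traces of [M] and M' agree; for l > i the
   trace of [M] is an extension of Delta(l) by the trace of M'. *)
case: (leqP l i) => li.
  have kD (k : 'I_n) : (i < k)%N -> kills k (Delta l).
    by move=> ik; apply: Delta_kills; apply: leq_ltn_trans ik.
  have [|s hs] := @factor_inj _ _ _ _ (j \o t' : {linear _ -> _}) t (inj_comp ij it').
    move=> x; have : trace i M (t x) by apply/ht; exists x.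
    move=> /(_ _ (sm_range (j \o t' : {linear _ -> _}))); apply=> k y ik.
    have [m em] := kills_idem y h (kD k ik).
    have /ht'[z ez] : trace i M' (e k *: m) by apply: trace_e.
    by exists z; rewrite /= ez linearZ_LR em scalerA idemM.
  by apply: (orth_retract (i := s) (r := r)) IH => x; apply: it; rewrite hr hs.
have [K [k [d [_ _ _]]]] := Delta_pres l => {K k d}.
have [K [k [d [hd _ _]]]] := Delta_pres l; have [_ sd _] := hd.
have surjq : surj (p \o t).
  move=> z; have [a ->] := Delta_gen sd z; have [m em] := sp (d (gen l)).
  have /ht[y ey] : trace i M (e l *: m) by apply: trace_e.
  by exists (a *: y); rewrite /= !linearZ_LR ey linearZ_LR em -linearZ_LR e_gen.
apply: (orth_ext (j := r) (p := p \o t : {linear _ -> _})) IH (hY l li).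
split=> // y; split=> [/kp[x ex]|[x <-]]; last first.
  by rewrite /= hr /= (ses_pj _ h).
(* It remains to see that M' meets the trace of [M] only in its own trace. The projection of M'
   modulo its trace extends to [M], as Ext^1(Delta(l), Z) = 0, and the extension kills the trace of
   [M]. *)
have [Z [q [sq kq]]] := quo_ex (trace_sm i M').
have kZ (k' : 'I_n) : (i < k')%N -> kills k' Z.
  by move=> ik z; have [m <-] := sq z; rewrite -linearZ_LR; apply/kq; apply: trace_e.
have [|g hg] := orth_Delta_killed (j := l) (Z := Z) _ h q.
  by move=> k' lk; apply: kZ; apply: leq_trans li (ltnW lk).
have /kq/ht'[x' ex'] : q x = 0.
  by rewrite -hg ex; apply: trace_kernel kZ _; apply/ht; exists y.
by exists x'; apply: it; rewrite hr /= ex'.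
Qed.

(** * Modules with Ext^1(Delta, -) = 0 and their filtrations *)

Hypothesis hstrat : standardly_stratified Delta.

(** P(i) is a retract of A and traces are functorial, so [K] is a retract of the trace of A, to
    which the stratification applies. *)
Lemma orth_Delta_kernel i K (j : {linear K -> P i}) (d : {linear P i -> Delta i}) Y :
  ses j d -> (forall x, d x = 0 <-> trace i (P i) x) ->
  (forall l : 'I_n, (i < l)%N -> orth (Delta l) Y) -> orth K Y.
Proof.
move=> h kerd hY; have [ij sd kd] := h.
have [N [t [it ht]]] := sub_ex (trace_sm i A^o).
have oN := orth_trace hY hstrat it ht.
have [r pr] := P_retract i.
have [s hs] : exists s : {linear K -> N}, forall x, t (s x) = (pval i \o j) x.
  apply: factor_inj => // x; apply/ht; apply: (trace_map (pval i)); apply/kerd.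
  exact: ses_pj h.
have [r' hr'] : exists r' : {linear N -> K}, forall x, j (r' x) = (r \o t) x.
  apply: factor_inj => // x; apply/kd/kerd; apply: (trace_map r); apply/ht.
  by exists x.
by apply: (orth_retract (i := s) (r := r')) oN => x; apply: ij; rewrite hr' /= hs /= pr.
Qed.

(* By [goodP] below, these are the modules filtered by [pnabla]. *)
Definition good Y : Prop := fin_gen Y /\ forall i, orth (Delta i) Y.

Lemma good_pnabla i : good (pnabla i).
Proof. by split=> [|j]; [exact: fin_gen_pnabla | exact: orth_Delta_pnabla]. Qed.

Lemma good_zero Y : zero_mod Y -> good Y.
Proof.
move=> hz; split=> [|i]; first exact: fin_gen_zero.
by apply: orth_Delta_killed => l _ x; apply: hz.
Qed.

(** The obstruction Ext^2(Delta(i), X) is Ext^1 from the presentation kernel of Delta(i), and that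
    vanishes by [orth_Delta_kernel]. *)
Lemma good_coker X Y Z (j : {linear X -> Y}) (p : {linear Y -> Z}) :
  ses j p -> good X -> good Y -> good Z.
Proof.
move=> h [fX oX] [fY oY]; have [_ sp _] := h; split=> [|i]; first exact: fin_gen_surj fY.
have [K [k [d [hd kd _]]]] := Delta_pres i.
apply: (orth_coker hd (@P_proj i) h) => //.
by apply: orth_Delta_kernel hd kd _ => l _.
Qed.

Lemma good_ext X Y Z (j : {linear X -> Y}) (p : {linear Y -> Z}) :
  ses j p -> good X -> good Z -> good Y.
Proof.
move=> h [fX oX] [fZ oZ]; split=> [|i]; first exact: fin_gen_ext h fX fZ.
have [K [k [d [hd kd _]]]] := Delta_pres i.
exact: (orth_ext_r hd (@P_proj i) h).
Qed.

Lemma filtered_good Y : filtered_by pnabla Y -> good Y.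
Proof.
move: Y; apply: filtered_ind => [M|M' M D j p h [i eD] _ gM]; first exact: good_zero.
by subst D; apply: good_ext h gM (good_pnabla i).
Qed.

Lemma killed_hom_zero (i : 'I_n) Q : fin_gen Q ->
  (forall l : 'I_n, (l < i)%N -> ~ exists k : {linear E l -> Q}, injective k) ->
  forall X (f : {linear X -> Q}), (forall l : 'I_n, (i <= l)%N -> kills l X) ->
  forall x, f x = 0.
Proof.
move=> fQ min X f hX x; have [N [k [ik hk]]] := sub_ex (sm_range f).
have kN (l : 'I_n) : (i <= l)%N -> kills l N.
  move=> il y; apply: (inj_lin0 ik); rewrite linearZ_LR.
  have /hk[x' <-] : exists y', k y' = k y by exists y.
  by rewrite -linearZ_LR hX // linear0.
have fN : fin_gen N by apply: fin_gen_sub ik fQ.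
case: (pselect (zero_mod N)) => hz.
  by have /hk[y <-] : exists x', f x' = f x by [exists x]; rewrite (hz y) linear0.
have [S [s [simS is_]]] := simple_sub (finA _ fN) hz.
have [l /iso_modP[u [u' [_ u'u]]]] := simple_E_sub simS.
case: (ltnP l i) => li.
  case: (min l li); exists (k \o s \o u' : {linear _ -> _}).
  by do 2 ?apply: inj_comp => //; apply: can_inj u'u.
case: (@E_not_killed l); apply: (kills_surj (p := u)); first by move=> y; exists (u' y).
exact: kills_inj is_ (kN l li).
Qed.

(** By induction on length, [X] may be taken simple with some index j < i. It is a factor of
    Delta(j) whose kernel has all factors of index < i, hence no nonzero map to [Q], and [orth_quot]
    applies. *)
Lemma killed_orth (i : 'I_n) Q : good Q ->
  (forall l : 'I_n, (l < i)%N -> ~ exists k : {linear E l -> Q}, injective k) ->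
  forall X, fin_gen X -> (forall l : 'I_n, (i <= l)%N -> kills l X) -> orth X Q.
Proof.
move=> [fQ oQ] min; apply: (finlen_ind finA) => [X hz _|S X X'' s p h simS fX _ IH hX].
  exact: orth_zero.
have [is_ sp _] := h.
apply: (orth_ext h); last by apply: IH => l il; apply: kills_surj sp (hX l il).
have kS (l : 'I_n) : (i <= l)%N -> kills l S by move=> il; apply: kills_inj is_ (hX l il).
have [x nx] : exists x : S, x <> 0.
  by apply: contrapT => hh; apply: simS.1 => x; apply: contrapT => nx; apply: hh; exists x.
have [j0 hj0] := e_nonzero nx.
have ex0 : `[< ~ kills j0 S >] by apply/asboolP => /(_ x).
(* Taking the largest index not killing [S] ensures that P(j) -> S factors through Delta(j). *)
case: (@arg_maxnP _ j0 (fun j => `[< ~ kills j S >]) (fun j => j : nat) ex0) => j /asboolP nj maxj.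
have ji : (j < i)%N by rewrite ltnNge; apply/negP => /kS.
have [y ny] : exists y : S, e j *: y <> 0.
  by apply: contrapT => hh; apply: nj => y; apply: contrapT => ny; apply: hh; exists y.
have [K [k [d [hd kd maxd]]]] := Delta_ses j; have [_ sd _] := hd.
have [f hf] := P_map j y.
have sf : surj f by case: (simple_range f simS) => // h0; case: ny; rewrite -hf h0.
have [g hg] : exists g : {linear Delta j -> S}, forall z, g (d z) = f z.
  apply: factor_surj => //; apply: maxd => // l jl; apply: contrapT => nl.
  have /asboolP/maxj : ~ kills l S := nl.
  by rewrite /= leqNgt jl.
have sg : surj g by move=> z; have [w <-] := sf z; exists (d w).
have [R [r hr]] := ses_ker sg; have [ir _ _] := hr.
apply: (orth_quot hr) => //.
move=> u; apply: (killed_hom_zero fQ min) => l il; apply: kills_inj ir _.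
by apply: kd; apply: leq_trans ji il.
Qed.

(** For the least i with E(i) in the socle of [Q], the embedding of E(i) extends to [pnabla i],
    since the remaining factors of [pnabla i] have index < i. The extension is injective on the
    essential socle, hence injective, and its cokernel is again good: Noetherian induction. *)
Lemma good_filtered Y : good Y -> filtered_by pnabla Y.
Proof.
move=> gY; have [fY _] := gY; move: Y {fY} (finA true fY) gY.
apply: noeth_ind => Q _ IH gQ; have [fQ oQ] := gQ.
case: (pselect (zero_mod Q)) => nz; first exact: filtered_zero.
have [S [s [simS is_]]] := simple_sub (finA _ fQ) nz.
have [i0 /iso_modP[u [u' [_ u'u]]]] := simple_E_sub simS.
have ex0 : `[< exists k : {linear E i0 -> Q}, injective k >].
  apply/asboolP; exists (s \o u' : {linear _ -> _}).
  by apply: inj_comp => //; apply: can_inj u'u.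
case: (@arg_minnP _ i0 (fun i => `[< exists k : {linear E i -> Q}, injective k >])
  (fun i => i : nat) ex0) => i /asboolP[k ik] mini.
have min (l : 'I_n) : (l < i)%N -> ~ exists k : {linear E l -> Q}, injective k.
  by move=> li /asboolP/mini; rewrite /= leqNgt li.
have [v [iota [iv ii kpn eiota [ess _]]]] := pnabla_socle i.
have [C [c h]] := ses_coker ii; have [_ sc kc] := h.
have oC : orth C Q.
  apply: (killed_orth gQ min); first exact: fin_gen_surj sc (fin_gen_pnabla i).
  move=> l il z; have [x <-] := sc z; rewrite -linearZ_LR; apply/kc.
  exact: eiota.
have [f hf] := oC _ _ _ _ h k.
have if_ : injective f.
  apply: lin_inj; apply: (ess _ (sm_ker f)) => x /=; rewrite hf; exact: inj_lin0.
have [Q' [q hq]] := ses_coker if_; have [_ sq _] := hq.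
apply: (filtered_ext hq); first by apply: filtered_one; exists i.
apply: (IH _ q sq); last exact: good_coker hq (good_pnabla i) gQ.
have [t [nt _]] := E_gen i; exists (f (iota t)); last exact: ses_pj hq.
by move=> /(inj_lin0 if_)/(inj_lin0 ii).
Qed.

Lemma goodP Y : good Y <-> filtered_by pnabla Y.
Proof. by split; [exact: good_filtered | exact: filtered_good]. Qed.
(** * Homological dimensions *)

Hypothesis homA : forall M N : lmodType A, fin_gen M -> fin_gen N ->
  exists m (f : 'I_m -> {linear M -> N}), forall g : {linear M -> N},
    exists c : 'I_m -> A, (forall i a, a * c i = c i * a) /\
      forall x, g x = \sum_i c i *: f i x.

(** One pushout of the presentation of Delta(i) for each [f k], composed; every pushout adds a copy
    of Delta(i) to the cokernel. *)
Lemma extend_maps i K (j : {linear K -> P i}) (d : {linear P i -> Delta i}) : ses j d ->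
  forall m X (f : 'I_m -> {linear K -> X}),
  exists X' (u : {linear X -> X'}) D (q : {linear X' -> D}),
    [/\ ses u q, filtered (fun M => M = Delta i) D &
        forall k, exists g : {linear P i -> X'}, forall x, g (j x) = u (f k x)].
Proof.
move=> h; elim=> [|m IH] X f.
  have [Z hZ] := zero_exists A.
  exists X, idfun, Z, \0; split; [|exact: filtered_zero|by case].
  split=> [x y|z|y] //; first by exists 0; rewrite (hZ z).
  by split=> // _; exists y.
have [X1 [g1 [u1 [q1 [h1 e1 _]]]]] := pushout_ses (f ord0) h.
have [X2 [u2 [D2 [q2 [h2 fD2 ext2]]]]] :=
  IH X1 (fun k => u1 \o f (lift ord0 k) : {linear _ -> _}).
have [D [q [i1 [r [hq hD]]]]] := ses_comp h1 h2.
exists X2, (u2 \o u1 : {linear _ -> _}), D, q; split=> //.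
  by apply: (filtered_ext hD) => //; apply: filtered_one.
move=> k; case: (unliftP ord0 k) => [k'|] ->; first exact: ext2.
by exists (u2 \o g1 : {linear _ -> _}) => x /=; rewrite e1.
Qed.

Lemma filtered_one_kills i D : filtered (fun M => M = Delta i) D ->
  forall l : 'I_n, (i < l)%N -> kills l D.
Proof.
move: D; apply: filtered_ind => [M hz l _ x|M' M D j p h eD _ IH l il]; first exact: hz.
by subst D; apply: kills_ses h (IH l il) (Delta_kills il).
Qed.

Lemma filtered_fin_gen M : filtered_by Delta M -> fin_gen M.
Proof.
move: M; apply: filtered_ind => [M hz|M' M D j p h [i eD] _ fM]; first exact: fin_gen_zero.
by subst D; apply: fin_gen_ext h fM (fin_gen_Delta i).
Qed.

(** Extending finitely many generators of Hom(K, X) over P(i) annihilates Ext^1(Delta(i), -).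
    Vanishing for larger indices survives, because the kernels of their presentations have no
    nonzero maps to the new part [D]. *)
Lemma universal_extension (i : 'I_n) X : fin_gen X ->
  (forall j : 'I_n, (i < j)%N -> orth (Delta j) X) ->
  exists X' (u : {linear X -> X'}) D (q : {linear X' -> D}),
    [/\ ses u q, filtered_by Delta D, fin_gen X' &
        forall j : 'I_n, (i <= j)%N -> orth (Delta j) X'].
Proof.
move=> fX oX; have [K [k [d [hi _ Kzero]]]] := Delta_pres i.
have [ik _ _] := hi.
have [m [f hf]] := homA (fin_gen_sub finA ik (P_fin_gen i)) fX.
have [X' [u [D [q [h fD ext]]]]] := extend_maps hi f.
have [iu sq kq] := h.
have fD' : filtered_by Delta D.
  have [m' [U [N [h1 h2]]]] := fD; exists m', U, N; split=> // t /h2[M eM isoN].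
  by exists M => //; exists i.
exists X', u, D, q; split=> //.
  exact: fin_gen_ext h fX (filtered_fin_gen fD').
have lands (L : lmodType A) (g : {linear L -> X'}) :
    (forall Y (f : {linear L -> Y}), (forall l : 'I_n, (i < l)%N -> kills l Y) ->
       forall x, f x = 0) ->
    exists g0 : {linear L -> X}, forall z, u (g0 z) = g z.
  move=> Lz; apply: factor_inj => // z; apply/kq.
  exact: (Lz _ (q \o g : {linear _ -> _}) (filtered_one_kills fD)).
move=> j; rewrite leq_eqVlt => /orP[/eqP/val_inj <-|ij].
  apply: (orth_pres hi (@P_proj i)) => g; have [g0 hg0] := lands _ g Kzero.
  have [c [cc hc]] := hf g0; have /choice[g1 hg1] := ext.
  (* Centrality of the coefficients [c] is what makes this combination A-linear. *)
  have lg : linear (fun x : P i => \sum_t c t *: g1 t x).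
    move=> a x y; rewrite scaler_sumr -big_split; apply: eq_bigr => t _ /=.
    by rewrite linearP scalerDr !scalerA cc.
  exists (mklin lg) => x; rewrite -hg0 hc linear_sum; apply: eq_bigr => t _.
  by rewrite hg1 linearZ_LR.
have [L [l [dj [hj _ Lzero]]]] := Delta_pres j.
apply: (orth_pres hj (@P_proj j)) => g; have [|g0 hg0] := lands _ g.
  by move=> Y f' hY; apply: Lzero => l' jl; apply: hY; apply: ltn_trans jl.
have [g1 hg1] := oX j ij _ _ _ _ hj g0.
by exists (u \o g1 : {linear _ -> _}) => x; rewrite /= hg1 hg0.
Qed.

(** Universal extensions are applied from the largest index downwards. The condition [n <= j + k]
    singles out the last [k] indices; the next extension is at index [n - k.+1]. *)
Lemma good_approx X : fin_gen X ->
  exists Y (u : {linear X -> Y}) D (q : {linear Y -> D}),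
    [/\ ses u q, good Y & filtered_by Delta D].
Proof.
move=> fX; suff main k : exists Y (u : {linear X -> Y}) D (q : {linear Y -> D}),
    [/\ ses u q, filtered_by Delta D, fin_gen Y &
        forall j : 'I_n, (n <= j + k)%N -> orth (Delta j) Y].
  have [Y [u [D [q [h fD fY oY]]]]] := main n; exists Y, u, D, q; split=> //.
  by split=> // j; apply: oY; rewrite leq_addl.
elim: k => [|k [Y [u [D [q [h fD fY oY]]]]]].
  have [Z hZ] := zero_exists A; exists X, idfun, Z, \0; split=> //.
  - split=> [x y|z|y] //; first by exists 0; rewrite (hZ z).
    by split=> // _; exists y.
  - exact: filtered_zero.
  - by move=> j; rewrite addn0 leqNgt ltn_ord.
case: (leqP n k) => nk.
  exists Y, u, D, q; split=> // j _; apply: oY.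
  exact: leq_trans nk (leq_addl _ _).
have hi : (n - k.+1 < n)%N by rewrite ltn_subrL ltnS (leq_ltn_trans _ nk).
have [|Y' [u' [D' [q' [h' fD' fY' oY']]]]] := universal_extension (i := Ordinal hi) fY.
  by move=> j /= ij; apply: oY; rewrite addnC -leq_subLR -subnSK.
have [D1 [q1 [i1 [r1 [h1 hD1]]]]] := ses_comp h h'.
exists Y', (u' \o u : {linear _ -> _}), D1, q1; split=> //.
  exact: filtered_ext hD1 fD fD'.
by move=> j nj; apply: oY'; rewrite /= leq_subLR addnC.
Qed.

(** Induction on length: an embedding of X/S is combined with an extension to [X] of S -> I(i); an
    element killed by the first lies in [S], where the second is injective. *)
Lemma injective_embedding X : fin_gen X ->
  exists W (w : {linear X -> W}), [/\ injective w, fin_gen W & injective_mod W].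
Proof.
move: X; apply: (finlen_ind finA) => [M hz|S X X'' s p h simS fX fX'' [W [w [iw fW injW]]]].
  exists M, idfun; split=> // [|Y Z j f _]; first exact: fin_gen_zero.
  by exists \0 => x; rewrite (hz (f x)).
have [is_ sp kp] := h.
have [i /iso_modP[u [u' [uu' _]]]] := simple_E_sub simS.
have [fI injI [j [ij _]]] := hI i.
have [g hg] := injI _ _ s (j \o u : {linear _ -> _}) is_.
have hl : linear (fun x : X => (w (p x), g x)) by move=> a x y; rewrite !linearP.
exists (W * I i)%type, (mklin hl); split.
- apply: lin_inj => x [/(inj_lin0 iw) /kp[z ez] gx].
  rewrite -ez; suff -> : z = 0 by rewrite linear0.
  apply: (inj_lin0 (can_inj uu')); apply: (inj_lin0 ij).
  by rewrite -[j _]hg ez.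
- have [t ht] := ses_prod W (I i); exact: fin_gen_ext ht fW fI.
- exact: injective_prod.
Qed.

(** * Syzygies and the vanishing of higher Ext *)

Definition perp D : Prop := fin_gen D /\ forall Y, good Y -> orth D Y.

Lemma perp_Delta i : perp (Delta i).
Proof. by split=> [|Y [_]]; first exact: fin_gen_Delta. Qed.

Lemma perp_filtered M : filtered_by Delta M -> perp M.
Proof.
move=> fM; split=> [|Y [_ oY]]; first exact: filtered_fin_gen.
move: M fM; apply: filtered_ind => [M hz|M' M D j p h [i eD] _ oM]; first exact: orth_zero.
by subst D; apply: orth_ext h oM (oY i).
Qed.

Lemma good_injective W : fin_gen W -> injective_mod W -> good W.
Proof. by move=> fW iW; split=> // i; apply: orth_inj. Qed.

(** For good [Y] inside an injective [W], Ext^1(K, Y) is Ext^2(D, Y), hence Ext^1(D, W/Y), and W/Y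
    is good as a cokernel of good modules. *)
Lemma perp_syzygy K Q D (j : {linear K -> Q}) (p : {linear Q -> D}) :
  ses j p -> projective_mod Q -> fin_gen Q -> perp D -> perp K.
Proof.
move=> h prQ fQ [fD oD]; have [ij _ _] := h.
split=> [|Y gY]; first exact: fin_gen_sub ij fQ.
have [fY _] := gY; have [W [w [iw fW injW]]] := injective_embedding fY.
have [W' [q hW]] := ses_coker iw.
apply: (orth_syzygy h prQ hW); first exact: orth_inj.
by apply: oD; apply: good_coker hW gY (good_injective fW injW).
Qed.

(** All finitely generated projectives are allowed at each stage, so no resolution is ever fixed and
    degrees shift with whatever presentation is at hand. *)
Fixpoint syzygy d K : Prop :=
  if d is d'.+1 then exists D Q (j : {linear K -> Q}) (p : {linear Q -> D}),
    [/\ ses j p, projective_mod Q, fin_gen Q & syzygy d' D] else perp K.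

Lemma syzygy_perp d K : syzygy d K -> perp K.
Proof.
elim: d K => [|d IH] K //= [D [Q [j [p [h prQ fQ /IH hD]]]]].
exact: perp_syzygy h prQ fQ hD.
Qed.

Lemma syzygy_le m d K : (m <= d)%N -> syzygy d K -> syzygy m K.
Proof.
elim: d m K => [|d IH] [|m] K // md; first exact: syzygy_perp.
move=> [D [Q [j [p [h prQ fQ /(IH m) hD]]]]].
by exists D, Q, j, p; split=> //; apply: hD.
Qed.

(* Ext^(d+1)(D, X) = 0 for all D in the left orthogonal class of F(pnabla). *)
Definition ext_vanish d X : Prop := forall K, syzygy d K -> orth K X.

Lemma ext_vanish_le m d X : (m <= d)%N -> ext_vanish m X -> ext_vanish d X.
Proof. by move=> md h K /(syzygy_le md); apply: h. Qed.

Lemma syzygy_pres d K : syzygy d K -> exists K' m (j : {linear K' -> free_mod A m}) (p : {linear free_mod A m -> K}),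
  ses j p /\ syzygy d.+1 K'.
Proof.
move=> hK; have [fK _] := syzygy_perp hK; have [K' [m [j [p h]]]] := free_pres fK.
exists K', m, j, p; split=> //; exists K, (free_mod A m), j, p; split=> //.
  exact: projective_free.
exact: fin_gen_free.
Qed.

(** Syzygies of modules in [perp] stay in [perp], so every Ext with values in the good module [M]
    vanishes and the connecting map shifts the degree by one. *)
Lemma ext_vanish_shift d X M X' (i : {linear X -> M}) (q : {linear M -> X'}) :
  ses i q -> good M -> ext_vanish d.+1 X <-> ext_vanish d X'.
Proof.
move=> h gM; split=> hX K hK.
  have [K' [m [j [p [hp hK']]]]] := syzygy_pres hK.
  apply: (orth_coker hp _ h); [exact: projective_free | exact: hX |].
  by have [_] := syzygy_perp hK; apply.
have [_ oK] := syzygy_perp hK; have [D [Q [j [p [hp prQ fQ hD]]]]] := hK.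
by apply: (orth_syzygy hp prQ h); [exact: oK | exact: hX].
Qed.

Lemma cores_ext_vanish d X : fin_gen X -> cores good d X <-> ext_vanish d X.
Proof.
elim: d X => [|d IH] X fX /=.
  split=> [gX K [_]|hX]; first by apply.
  by split=> // i; apply: hX; apply: perp_Delta.
split=> [[M [X' [i [q [h gM cX']]]]]|hX].
  have [_ sq _] := h; have [fM _] := gM.
  by apply/(ext_vanish_shift _ h gM)/IH => //; apply: fin_gen_surj fM.
have [Y [u [D [q [h gY fD]]]]] := good_approx fX.
exists Y, D, u, q; split=> //; apply/IH; first exact: filtered_fin_gen.
exact/(ext_vanish_shift _ h gY).
Qed.

(** After [m] steps the cokernel satisfies Ext^1(Delta(j), -) = 0 for the last [m] indices. The next
    step gains an index because Ext^2(Delta(j), -) only sees the Delta(l) with l > j. *)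
Lemma good_cores_n X : fin_gen X -> cores good n X.
Proof.
move=> fX; suff main r m X' : (m + r = n)%N -> fin_gen X' ->
    (forall j : 'I_n, (n <= j + m)%N -> orth (Delta j) X') -> cores good r X'.
  by apply: (main n 0%N) => // j; rewrite addn0 leqNgt ltn_ord.
elim: r m X' {X fX} => [|r IH] m X mr fX oX.
  by split=> // j; apply: oX; rewrite -[X in (X <= _)%N]mr addn0 leq_addl.
have [Y [u [D [q [h gY fD]]]]] := good_approx fX.
exists Y, D, u, q; split=> //; apply: (IH m.+1); first by rewrite addSnnS.
  exact: filtered_fin_gen.
move=> j nj; have [K [k [d [hj kd _]]]] := Delta_pres j; have [_ oY] := gY.
apply: (orth_coker hj (@P_proj j) h) => //.
apply: (orth_Delta_kernel hj kd) => l jl; apply: oX.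
by apply: leq_trans nj _; rewrite addnS -addSn leq_add2r.
Qed.

Lemma cores_regular d : cores good d A^o -> forall X, fin_gen X -> cores good d X.
Proof.
move=> /(cores_ext_vanish _ (fin_gen_regular A)) eA.
suff main k m : (d <= m)%N -> (n <= m + k)%N -> forall X, fin_gen X -> ext_vanish m X.
  move=> X fX; apply/cores_ext_vanish => //.
  by apply: (main n d) => //; rewrite leq_addl.
elim: k m => [|k IH] m dm nm X fX.
  rewrite addn0 in nm; apply: (ext_vanish_le nm); apply/cores_ext_vanish => //.
  exact: good_cores_n.
(* In terms of the module of which [K] is an m-th syzygy: Ext^(m+1)(D, X) sits between Ext^(m+1)(D,
   A^t), zero by the hypothesis on A, and Ext^(m+2)(D, R), zero by the previous step of the descent
   from degree [n]. *)
move=> K hK; have [R [t [r [p hr]]]] := free_pres fX; have [ir _ _] := hr.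
have [K' [m' [j [q [hq hK']]]]] := syzygy_pres hK.
apply: (orth_coker hq _ hr); first exact: projective_free.
  apply: (IH m.+1) hK' => //; first exact: leqW.
    by rewrite addSnnS.
  exact: fin_gen_sub ir (fin_gen_free A t).
by apply: orth_free; apply: eA; apply: syzygy_le hK.
Qed.

Definition fgproj Q := fin_gen Q /\ projective_mod Q.

Lemma orth_projective K D : fin_gen D -> (forall X, fin_gen X -> orth D X) -> projective_mod D.
Proof.
move=> fD oD; have [R [m [j [p h]]]] := free_pres fD; have [ij sp kp] := h.
have [r hr] := oD _ (fin_gen_sub finA ij (fin_gen_free A m)) _ _ _ _ h idfun.
have [|s hs] := factor_surj (f := idfun \- (j \o r) : {linear free_mod A m -> free_mod A m}) sp.
  by move=> x /kp[y <-] /=; rewrite hr subrr.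
apply: (proj_retract (i := s) (r := p)) => [x|]; last exact: projective_free.
by have [y <-] := sp x; rewrite hs /= linearB (ses_pj _ h) subr0.
Qed.

(** After [k] free presentations the syzygy has Ext^1 zero against all finitely generated modules,
    in particular against its own presentation kernel, so it is projective. *)
Lemma res_of_ext_vanish k s D : syzygy s D ->
  (forall X, fin_gen X -> ext_vanish (s + k) X) -> res fgproj k D.
Proof.
elim: k s D => [|k IH] s D hD eX /=; have [fD _] := syzygy_perp hD.
  split=> //; apply: orth_projective => // X /eX; rewrite addn0; exact.
have [K [m [j [p [h hK]]]]] := syzygy_pres hD.
exists (free_mod A m), K, j, p; split=> //.
  by split; [exact: fin_gen_free | exact: projective_free].
by apply: (IH s.+1) => // X /eX; rewrite addnS.
Qed.

(** * The characteristic module *)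

Variable T : lmodType A.
Hypothesis hT : is_characteristic Delta pnabla T.

Lemma add_filtered M : in_add T M <-> filtered_by Delta M /\ filtered_by pnabla M.
Proof. by case: hT. Qed.

Lemma add_good M : in_add T M -> good M.
Proof. by move=> /add_filtered[_ /goodP]. Qed.

Lemma add_zero Z : zero_mod Z -> in_add T Z.
Proof. by move=> hZ; apply/add_filtered; split; apply: filtered_zero. Qed.

Lemma split_iso C N (i : {linear C -> N}) (r : {linear N -> C}) :
  cancel i r -> exists M', iso_mod N (C * M')%type.
Proof.
move=> ir; have [K [j [ij hj]]] := sub_ex (sm_ker r); exists K; apply: iso_sym.
have h : linear (fun x : C * K => i x.1 + j x.2).
  by move=> a x y /=; rewrite !linearP scalerDr addrACA.
apply: (iso_surj (f := mklin h)).
  apply: lin_inj => -[x y] e0; have {}e0 : i x + j y = 0 := e0.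
  have rj : r (j y) = 0 by apply/hj; exists y.
  have x0 : x = 0.
    by have := congr1 r e0; rewrite linearD ir rj addr0 linear0.
  have y0 : y = 0 by apply: (inj_lin0 ij); move: e0; rewrite x0 linear0 add0r.
  by rewrite x0 y0.
move=> y; have /hj[z ez] : r (y - i (r y)) = 0 by rewrite linearB ir subrr.
by exists (r y, z); change (i (r y) + j z = y); rewrite ez addrC subrK.
Qed.

Lemma in_addP M : in_add T M <->
  exists m (i : {linear M -> {ffun 'I_m -> T}}) (r : {linear {ffun 'I_m -> T} -> M}), cancel i r.
Proof.
split=> [[m [M' /iso_modP[f [g [fg gf]]]]]|[m [i [r ir]]]]; last first.
  by have [M' isoM] := split_iso ir; exists m, M'.
have h : linear (fun x : M => (x, 0 : M')).
  by move=> a x y; congr pair; rewrite /= scaler0 addr0.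
exists m, (g \o mklin h : {linear _ -> _}), (fst \o f : {linear _ -> _}) => x /=.
by rewrite gf.
Qed.

Lemma add_retract C M (i : {linear C -> M}) (r : {linear M -> C}) :
  cancel i r -> in_add T M -> in_add T C.
Proof.
move=> ir /in_addP[m [i' [r' ir']]]; apply/in_addP.
exists m, (i' \o i : {linear _ -> _}), (r \o r' : {linear _ -> _}).
exact: can_comp.
Qed.

Lemma add_T : in_add T T.
Proof.
have hi : linear (fun x : T => [ffun _ : 'I_1 => x]).
  by move=> a x y; apply/ffunP => k; rewrite !ffunE.
have hr : linear (fun f : {ffun 'I_1 -> T} => f ord0) by move=> a x y; rewrite !ffunE.
by apply/in_addP; exists 1%N, (mklin hi), (mklin hr) => x; rewrite [LHS]ffunE.
Qed.

Lemma add_iso M N : iso_mod M N -> in_add T M -> in_add T N.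
Proof. by move=> /iso_modP[f [g [_ gf]]]; apply: add_retract gf. Qed.

Lemma orth_add C Y : in_add T C -> orth T Y -> orth C Y.
Proof. by move=> /in_addP[m [i [r ir]]] oT; apply: orth_retract ir _; apply: orth_pow. Qed.

(** For [D] in F(Delta) the approximating good module is an extension of modules in F(Delta), hence
    lies in add T, and the cokernel stays in F(Delta). *)
Lemma good_cores_add d D : filtered_by Delta D -> cores good d D -> cores (in_add T) d D.
Proof.
elim: d D => [|d IH] D fD; first by move=> gD; apply/add_filtered; split=> //; apply/goodP.
move=> /(cores_ext_vanish _ (filtered_fin_gen fD)) eD.
have [Y [u [D' [q [h gY fD']]]]] := good_approx (filtered_fin_gen fD).
exists Y, D', u, q; split=> //.
  by apply/add_filtered; split; [exact: filtered_ext h fD fD' | apply/goodP].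
apply: IH => //; apply/cores_ext_vanish; first exact: filtered_fin_gen.
exact/(ext_vanish_shift _ h gY).
Qed.

Lemma add_cores_good d X : cores (in_add T) d X -> cores good d X.
Proof.
elim: d X => [|d IH] X; first exact: add_good.
by move=> [M [X' [i [q [h /add_good gM /IH cX]]]]]; exists M, X', i, q.
Qed.

(* There is no condition in degree 0: the shifting argument of [projdim_orth]
   works for a coresolution of any module. *)
Fixpoint cosyzygy s C : Prop :=
  if s is s'.+1 then exists C' M (i : {linear C' -> M}) (q : {linear M -> C}),
    [/\ ses i q, good M & cosyzygy s' C'] else True.

(** Shifting both arguments, Ext^1(D, C) is pushed to Ext^1 of the k-th syzygy of [D], which is
    projective; [k <= s] guarantees enough cosyzygy steps. *)
Lemma projdim_orth k s D C : res fgproj k D -> perp D -> (k <= s)%N ->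
  cosyzygy s C -> orth D C.
Proof.
elim: k s D C => [|k IH] s D C; first by move=> [_ prD] *; apply: orth_proj.
move=> [Q [K [j [p [h [fQ prQ] rK]]]]] pD; case: s => // s ks [C' [M [i [q [hC gM cC]]]]].
have pK := perp_syzygy h prQ fQ pD.
apply: (orth_coker h prQ hC); first exact: IH rK pK ks cC.
by have [_] := pD; apply.
Qed.

Section ProjDim.
Variable k : nat.
Hypothesis rT : res fgproj k T.

(** Working back from the end of the coresolution, C' lies in add T, and Ext^1(T, C) = 0 by
    dimension shifting. So the sequence splits and [C] is a summand of [M]. *)
Lemma cosyzygy_add r s C : (k <= s)%N -> cosyzygy s C -> cores (in_add T) r C -> in_add T C.
Proof.
elim: r s C => [|r IH] s C ks cC //= [M [C' [i [q [h aM cC']]]]].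
have aC' : in_add T C'.
  apply: (IH s.+1) => //; first exact: leqW.
  by exists C, M, i, q; split=> //; apply: add_good.
have [fT _] := iffLR (add_filtered T) add_T.
have oT : orth T C by apply: projdim_orth rT (perp_filtered fT) ks cC.
have [t ht] := orth_add aC' oT h idfun.
exact: (add_retract (i := i) (r := t)).
Qed.

(** Here [s] counts the steps already taken and [r] those left in the given coresolution; at s = k
    the current cosyzygy is itself in add T and the sequence is cut there. *)
Lemma cores_add_short r s C : (s <= k)%N -> cosyzygy s C -> cores (in_add T) r C ->
  cores (in_add T) (k - s) C.
Proof.
have add0 : exists2 Z, zero_mod Z & in_add T Z.
  by have [Z hZ] := zero_exists A; exists Z => //; apply: add_zero.
elim: r s C => [|r IH] s C sk cC.
  (* A coresolution ending before step [k] is padded with zero modules. *)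
  move=> aC; elim: (k - s)%N => [|t IHt] //; exact: cores_mono.
move=> cS; have [M [C' [i [q [h aM cC']]]]] := cS.
move: sk; rewrite leq_eqVlt => /orP[/eqP sk|sk].
  by rewrite sk subnn; apply: (cosyzygy_add _ cC cS); rewrite sk.
rewrite -subnSK //=.
exists M, C', i, q; split=> //; apply: IH => //.
by exists C, M, i, q; split=> //; apply: add_good.
Qed.

End ProjDim.

(** A lies in F(Delta), so its good coresolution of length [n] can be taken in add T; it is then
    cut, or padded, to length [k]. *)
Lemma projdim_cores_add k : res fgproj k T -> cores (in_add T) k A^o.
Proof.
move=> rT; rewrite -[k]subn0; apply: (cores_add_short rT (r := n)) => //.
by apply: good_cores_add => //; apply: good_cores_n; apply: fin_gen_regular.
Qed.

Lemma cores_projdim d : (forall X, fin_gen X -> cores good d X) -> res fgproj d T.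
Proof.
move=> hd; have [fT _] := iffLR (add_filtered T) add_T.
apply: (res_of_ext_vanish (s := 0)); first exact: perp_filtered.
by move=> X fX; apply/cores_ext_vanish => //; apply: hd.
Qed.

Lemma good_eq : good = filtered_by pnabla.
Proof. by apply: funext => X; apply/propext/goodP. Qed.

Lemma good_coresP X d : coresolution (filtered_by pnabla) X d <-> cores good d X.
Proof. by rewrite good_eq; apply: coresolutionP => M N; apply: filtered_iso. Qed.

(** The supremum becomes a uniform bound: a coresolution of length k gives one of every length b >=
    k, by passing through the vanishing of Ext. *)
Lemma sup_coresdimP b : (forall X, fin_gen X ->
    exists2 k, is_coresdim (filtered_by pnabla) X k & (k <= b)%N) <->
  forall X, fin_gen X -> cores good b X.
Proof.
split=> h X fX.
  have [k [/good_coresP/cores_ext_vanish hk _] kb] := h X fX.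
  by apply/cores_ext_vanish => //; apply: ext_vanish_le kb (hk fX).
have ex : exists k, `[< cores good k X >] by exists b; apply/asboolP/h.
case: (ex_minnP ex) => k /asboolP ck mink.
exists k; last by apply/mink/asboolP/h.
by split=> [|m /good_coresP cm]; [apply/good_coresP | apply/mink/asboolP].
Qed.

Lemma add_coresP X d : coresolution (in_add T) X d <-> cores (in_add T) d X.
Proof. exact: coresolutionP add_iso X d. Qed.

Lemma projdimP d :
  resolution (fun P => fin_gen P /\ projective_mod P) T d <-> res fgproj d T.
Proof.
apply: resolutionP => M N /iso_modP[f [g [fg gf]]] [fM pM]; split.
  by apply: fin_gen_surj fM => y; exists (g y).
exact: proj_retract gf pM.
Qed.

End Idempotents.

Lemma is_least_iff (P Q : nat -> Prop) d :
  (forall k, P k <-> Q k) -> is_least P d -> is_least Q d.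
Proof. by move=> PQ [/PQ Qd min]; split=> // k /PQ; apply: min. Qed.

Theorem theorem2p5 (R : comNzRingType) (A : algType R)
  (hA : artin_algebra A)
  (n : nat) (e : 'I_n -> A)
  (he : complete_primitive_orthogonal e)
  (hbasic : basic_idempotents e)
  (E I Delta nabla pnabla : 'I_n -> lmodType A)
  (hE : forall i, is_top (principal (e i)) (E i))
  (hI : forall i, is_injective_envelope (E i) (I i))
  (hDelta : is_standard (fun i => principal (e i)) E Delta)
  (hnabla : is_costandard I E nabla)
  (hpnabla : is_proper_costandard nabla E pnabla)
  (hstrat : standardly_stratified Delta)
  (T : lmodType A) (hT : is_characteristic Delta pnabla T)
  (d : nat) :
  [<-> is_sup_coresdim (filtered_by pnabla) d;
       is_projdim T d;
       is_coresdim (filtered_by pnabla) A^o d;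
       is_coresdim (in_add T) A^o d].
Proof.
have finA := artin_fin hA; have homA := artin_hom hA.
have supP := sup_coresdimP finA he hE hI hDelta hnabla hpnabla hstrat homA.
have goodcP := good_coresP finA he hE hI hDelta hnabla hpnabla hstrat.
have addcP := add_coresP T; have pdP := @projdimP A T.
have h12 := cores_projdim finA he hE hI hDelta hstrat homA hT.
have h24 := projdim_cores_add finA he hE hI hDelta hnabla hpnabla hstrat homA hT.
have h43 := add_cores_good finA he hE hI hDelta hnabla hpnabla hstrat hT.
have h31 := cores_regular finA he hE hI hDelta hstrat homA.
(* Each of the four numbers is a least bound, and the implications (1) => (2) => (4) => (3) => (1)
   hold for every bound [k]; so the four sets of bounds coincide. *)
tfae; apply: is_least_iff => k.
- by split=> [/supP/h12/pdP|/pdP/h24/h43/h31/supP].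
- by split=> [/pdP/h24/h43/goodcP|/goodcP/h31/h12/pdP].
- by split=> [/goodcP/h31/h12/h24/addcP|/addcP/h43/goodcP].
- by split=> [/addcP/h43/h31/supP|/supP/h12/h24/addcP].
Qed.
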